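(* Consider the VCG-Learn algorithm described in the context, with hyperparameters $\mathtt{est}\in\{\mathrm{ETC},\mathrm{OPT}\}$ and $\mathtt{price}\in\{\mathrm{AGE},\mathrm{SEL}\}$. Consider any agent $i$, and let $U_{i,T}$ be the sum of her utilities after $T$ rounds when she participates truthfully (while the others may not). The following hold for all $T>2K$. 1. Let $\mathtt{est}=\mathrm{ETC}$. When $\mathtt{price}=\mathrm{AGE}$: if agent $i$ participates by bids, $U_{i,T}\ge 0$ almost surely for all $T$, i.e. the algorithm is (almost surely) individually rational; if she participates by rewards, $$\mathbb E[U_{i,T}]\ \ge\ -10\,\sigma\sqrt{\log(|\mathcal S|T)}\;K^{1/3}T^{2/3}-4,\qquad\text{i.e. } \mathbb E[-U_{i,T}]\in\widetilde O(K^{1/3}T^{2/3}),$$ so that the algorithm is asymptotically individually rational. When $\mathtt{price}=\mathrm{SEL}$, $$\mathbb E[U_{i,T}]\ \ge\ -10\,\sigma n\sqrt{\log(|\mathcal S|T)}\;K^{1/3}T^{2/3}-4,\qquad\text{i.e. } \mathbb E[-U_{i,T}]\in\widetilde O(nK^{1/3}T^{2/3}).$$ 2. Let $\mathtt{est}=\mathrm{OPT}$. When $\mathtt{price}=\mathrm{AGE}$: if agent $i$ participates by bids, $U_{i,T}\ge 0$ almost surely for all $T$, i.e. the algorithm is individually rational; if she participates by rewards, $$\mathbb E[U_{i,T}]\ \ge\ -9\,\sigma\sqrt{|\mathcal S|\,T\log(|\mathcal S|T)}-6,\qquad\text{i.e. } \mathbb E[-U_{i,T}]\in\widetilde O(\sqrt{|\mathcal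 S|T}),$$ so that the algorithm is asymptotically individually rational. When $\mathtt{price}=\mathrm{SEL}$, $$\mathbb E[U_{i,T}]\ \ge\ -9\,\sigma n\sqrt{|\mathcal S|\,T\log(|\mathcal S|T)}-6,\qquad\text{i.e. } \mathbb E[-U_{i,T}]\in\widetilde O(n\sqrt{|\mathcal S|T}).$$
   Context: Problem. There are $n$ agents and a seller. There is a finite set of outcomes $\Omega$, a finite set of allocations $\mathcal S$, and maps $\phi_i:\Omega\to\mathcal S$ ($\phi_i(\omega)$ is agent $i$'s allocation under $\omega$). Agent $i$ has a value function $v_i:\mathcal S\to[0,1]$; write $v_i(\omega)=v_i(\phi_i(\omega))$. The seller has a known value function $v_0:\Omega\to\mathbb R$. In each round $t=1,2,\dots$ the mechanism chooses an outcome $\omega_t$ and prices $p_{i,t}$; agent $i$ then realises a reward $X_{i,t}$ drawn from a $\sigma$-sub-Gaussian distribution with mean $v_i(\phi_i(\omega_t))$ depending only on $i$ and the allocation $\phi_i(\omega_t)$, independently across agents and rounds. Participation. Each agent participates either by bids (she submits once, before round 1, a bid function $b_i:\mathcal S\to[0,1]$) or by rewards (at the end of each round she reports a number $Y_{i,t}$ to the mechanism). Being truthful means $b_i=v_i$, respectively $Y_{i,t}=X_{i,t}$ for all $t$. Non-truthful agents participating by rewards may choose $Y_{i,t}$ as any (possibly random) function of their own past allocations, prices, rewards and reports and their current allocation, price and reward. The round-$t$ utility of agent $i$ is $u_{i,t}=v_i(\omega_t)-p_{i,t}$, and $U_{i,T}=\sum_{t=1}^Tu_{i,t}$. Algorithm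 (VCG-Learn). Let $K$ be the minimum number of rounds needed to assign every allocation in $\mathcal S$ to every agent at least once. The algorithm proceeds in brackets $q=1,2,\dots$. Bracket $q$ starts with an explore phase of $K$ rounds, following a fixed non-adaptive sequence of outcomes that assigns every allocation to every agent at least once; prices are $0$ and reported rewards are collected. It is followed by $\lfloor\frac56Kq^{1/2}\rfloor$ further rounds. On such a round $t$ of bracket $q$: let $D_t$ be the set of explore-phase rounds before $t$ if $\mathtt{est}=\mathrm{ETC}$, and $D_t=\{1,\dots,t-1\}$ if $\mathtt{est}=\mathrm{OPT}$ (if an agent receives the same allocation several times in one explore phase, only one of those reports, chosen arbitrarily, is used). For an agent participating by rewards let $N_{i,t}(s)$ be the number of used rounds $\ell\in D_t$ with $\phi_i(\omega_\ell)=s$, let $\bar v_{i,t}(s)$ be the average of the corresponding reports $Y_{i,\ell}$ clipped to $[0,1]$, and let $\hat v_{i,t}(s),\check v_{i,t}(s)=\bar v_{i,t}(s)\pm\sigma\sqrt{\frac{5\log(t-qK+1)+2\log|\mathcal S|}{N_{i,t}(s)}}$ (upper, lower). For an agent participating by bids, $\bar v_{i,t}=\hat v_{i,t}=\check v_{i,t}=b_i$. The outcome is $\omega_t\in\mathrm{argmax}_{\omega}\big(v_0(\omega)+\sum_{i=1}^n\hat v_{i,t}(\phi_i(\omega))\big)$. Set $(f_{i,t},g_{i,t})=(\check v_{i,t},\hat v_{i,t})$ if $\mathtt{price}=\mathrm{AGE}$ and $(f_{i,t},g_{i,t})=(\hat v_{i,t},\check v_{i,t})$ if $\mathtt{price}=\mathrm{SEL}$.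 With $F_{-i,t}(\omega)=v_0(\omega)+\sum_{j\ne i}f_{j,t}(\phi_j(\omega))$ and $G_{-i,t}(\omega)=v_0(\omega)+\sum_{j\neq i}g_{j,t}(\phi_j(\omega))$, agent $i$ is charged $p_{i,t}=\max_{\omega}F_{-i,t}(\omega)-G_{-i,t}(\omega_t)$. Definitions. Let agent $i$ be truthful. A mechanism is individually rational (for her) if $U_{i,T}\ge0$ a.s. for all $T$ regardless of the behaviour of other agents, and asymptotically individually rational if $\lim_{T\to\infty}\frac1T\mathbb E[U_{i,T}]\ge0$ regardless of the behaviour of other agents. $\widetilde O$ hides factors polylogarithmic in $T$ and $|\mathcal S|$ and constants depending on $\sigma$. *)

(* Defs.v *)
From HB Require Import structures.
From mathcomp Require Import all_boot all_order all_algebra.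
From mathcomp Require Import all_classical all_reals all_analysis.

Set Implicit Arguments.
Unset Strict Implicit.
Unset Printing Implicit Defensive.

Import Order.TTheory GRing.Theory Num.Theory.
Import numFieldNormedType.Exports.

Local Open Scope classical_set_scope.
Local Open Scope ring_scope.

Inductive estimation := ETC | OPT.
Inductive pricing := AGE | SEL.
Inductive participation := ByBids | ByRewards.

Definition subgaussian (R : realType) (sigma m : R)
    (mu : probability (measurableTypeR R) R) : Prop :=
  ('E_mu[fun x : R => x] = m%:E)%E /\
  forall l : R, ('E_mu[fun x : R => expR (l * (x - m))%R]
                 <= (expR (l ^+ 2 * sigma ^+ 2 / 2))%:E)%E.

Record problem (R : realType) (sigma : R) (n : nat) (Omega S : finType) :=
  Problem {
    alloc : 'I_n -> Omega -> S;
    value : 'I_n -> S -> R;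
    value_bound : forall j s, 0 <= value j s <= 1;
    seller_value : Omega -> R;
    (* law of the reward of agent j when she receives the allocation s *)
    reward_law : 'I_n -> S -> probability (measurableTypeR R) R;
    reward_law_subgaussian :
      forall j s, subgaussian sigma (value j s) (reward_law j s) }.

Definition covers (n : nat) (Omega S : finType) (phi : 'I_n -> Omega -> S)
    (e : seq Omega) : Prop :=
  forall (j : 'I_n) (s : S), s \in map (phi j) e.

Record mechanism (n : nat) (Omega S : finType) (phi : 'I_n -> Omega -> S) :=
  Mechanism {
    est : estimation;
    price_rule : pricing;
    (* the outcomes of an explore phase, in order; K is [size explore] *)
    explore : seq Omega;
    explore_covers : covers phi explore;
    explore_min : forall e, covers phi e -> (size explore <= size e)%N;
    (* [kept q j s] is the position, in the explore phase of bracket q, of the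
       single round whose report is used as agent j's sample of s *)
    kept : nat -> 'I_n -> S -> nat;
    keptP : forall q j s, onth (map (phi j) explore) (kept q j s) = Some s }.

Record profile (R : realType) (n : nat) (S : finType) := Profile {
  mode : 'I_n -> participation;
  bid : 'I_n -> S -> R;                  (* irrelevant for [ByRewards] agents *)
  bid_bound : forall j s, 0 <= bid j s <= 1 }.

(* Rounds and brackets are numbered from 1. *)
Section timeline.
Variables (R : realType) (K : nat).

Definition exploit_len (q : nat) : nat :=
  Num.truncn (5 / 6 * K%:R * Num.sqrt q%:R : R).

Definition bracket_end (q : nat) : nat :=
  \sum_(1 <= r < q.+1) (K + exploit_len r).

(* the least q such that t <= bracket_end q, see [bracketP] *)
Definition bracket (t : nat) : nat :=
  find (fun q => t <= bracket_end q)%N (iota 0 t.+1).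

(* 0-based position of round t in its bracket *)
Definition bracket_pos (t : nat) : nat := (t - bracket_end (bracket t).-1).-1.

Definition explore_round (t : nat) : bool := (bracket_pos t < K)%N.

Lemma leq_bracket_end q : (0 < K -> q <= bracket_end q)%N.
Proof.
move=> K0; elim: q => // q IH; rewrite /bracket_end big_nat_recr//=.
by rewrite -[X in (X <= _)%N]addn1; apply: leq_add; [exact: IH | rewrite addn_gt0 K0].
Qed.

Lemma bracketP t : (0 < K -> 0 < t ->
  0 < bracket t /\ bracket_end (bracket t).-1 < t <= bracket_end (bracket t))%N.
Proof.
move=> K0 t0.
have hs : has (fun q => t <= bracket_end q)%N (iota 0 t.+1).
  by apply/hasP; exists t; [rewrite mem_iota /= add0n ltnS | exact: leq_bracket_end].
have lt_t : (bracket t < t.+1)%N by move: hs; rewrite has_find size_iota.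
have := nth_find 0%N hs; rewrite -/(bracket t) nth_iota// add0n => le_end.
have b0 : (0 < bracket t)%N.
  by rewrite lt0n; apply/eqP => b0; move: le_end; rewrite b0 /bracket_end big_geq// leqNgt t0.
split=> //; rewrite le_end andbT ltnNge.
have lt_b : ((bracket t).-1 < bracket t)%N by rewrite prednK.
have := before_find 0%N lt_b.
by rewrite nth_iota ?add0n ?(ltn_trans lt_b)// => ->.
Qed.

End timeline.

Section vcg_learn.
Context {R : realType} {sigma : R} {n : nat} {Omega S : finType}.
Variables (pb : problem sigma n Omega S) (mech : mechanism (alloc pb)).
Variable prof : profile R n S.

Let K := size (explore mech).

(* In this section [om] and [Y] are one realisation of the outcomes and of the
   reported rewards. *)
Section path.
Variables (om : nat -> Omega) (Y : 'I_n -> nat -> R).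

(* the report of round l is used for agent j's estimate of s *)
Definition used (j : 'I_n) (s : S) (l : nat) : bool :=
  (alloc pb j (om l) == s) &&
  if explore_round R K l then bracket_pos R K l == kept mech (bracket R K l) j s
  else if est mech is OPT then true else false.

Definition nsamples (j : 'I_n) (t : nat) (s : S) : nat :=
  \sum_(1 <= l < t) used j s l.

Definition sample_mean (j : 'I_n) (t : nat) (s : S) : R :=
  (\sum_(1 <= l < t | used j s l) Y j l) / (nsamples j t s)%:R.

Definition vbar (j : 'I_n) (t : nat) (s : S) : R :=
  match mode prof j with
  | ByBids => bid prof j s
  | ByRewards => Num.max 0 (Num.min 1 (sample_mean j t s))
  end.

Definition radius (j : 'I_n) (t : nat) (s : S) : R :=
  match mode prof j with
  | ByBids => 0
  | ByRewards =>
      sigma * Num.sqrt ((5 * ln (t%:R - (bracket R K t * K)%:R + 1)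
                         + 2 * ln #|S|%:R) / (nsamples j t s)%:R)
  end.

Definition vhat j t s : R := vbar j t s + radius j t s.
Definition vcheck j t s : R := vbar j t s - radius j t s.

Definition welfare (t : nat) (o : Omega) : R :=
  seller_value pb o + \sum_(j < n) vhat j t (alloc pb j o).

Definition welfare_but (f : 'I_n -> nat -> S -> R) (i : 'I_n) (t : nat)
    (o : Omega) : R :=
  seller_value pb o + \sum_(j < n | j != i) f j t (alloc pb j o).

Definition F_but : 'I_n -> nat -> Omega -> R :=
  welfare_but (if price_rule mech is AGE then vcheck else vhat).

Definition G_but : 'I_n -> nat -> Omega -> R :=
  welfare_but (if price_rule mech is AGE then vhat else vcheck).

(* The default value of the maximum is one of the maximised values, so it is
   the genuine maximum over all outcomes. *)
Definition price (i : 'I_n) (t : nat) : R :=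
  if explore_round R K t then 0
  else \big[Num.max/F_but i t (om t)]_(o : Omega) F_but i t o
       - G_but i t (om t).

Definition utility (i : 'I_n) (t : nat) : R :=
  value pb i (alloc pb i (om t)) - price i t.

Definition follows_vcg_learn (t : nat) : Prop :=
  if explore_round R K t then onth (explore mech) (bracket_pos R K t) = Some (om t)
  else forall o, welfare t o <= welfare t (om t).

End path.

Section run.
Context {d dE : measure_display} {W : measurableType d} {E : measurableType dE}.
Variable P : probability W R.
Variables (outcome : nat -> W -> Omega).
Variables (reward report : 'I_n -> nat -> {RV P >-> measurableTypeR R}).
Variable seed : 'I_n -> {RV P >-> E}.

Definition price_process (j : 'I_n) (t : nat) (w : W) : R :=
  price (outcome ^~ w) (fun j' l => report j' l w) j t.

Definition total_utility (i : 'I_n) (T : nat) (w : W) : R :=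
  \sum_(1 <= t < T.+1) utility (outcome ^~ w) (fun j l => report j l w) i t.

(* The values taken by X in rounds 1, ..., m *)
Definition history (A : Type) (m : nat) (X : nat -> A) : m.-tuple A :=
  [tuple X k.+1 | k < m].

(* Agent j's round-t report is a function of her private randomness, of her
   allocations, prices and rewards up to round t, and of her earlier reports.
   As S is finite, measurability for each fixed sequence of allocations is
   joint measurability. *)
Definition own_information_report (j : 'I_n) (t : nat) : Prop :=
  exists psi : t.-tuple S ->
      E * (t.-tuple (measurableTypeR R) * t.-tuple (measurableTypeR R)
           * t.-1.-tuple (measurableTypeR R)) -> measurableTypeR R,
    (forall a, measurable_fun setT (psi a)) /\
    forall w, report j t w =
      psi (history t (fun l => alloc pb j (outcome l w)))
          (seed j w, (history t (fun l => price_process j l w),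
                      history t (fun l => reward j l w),
                      history t.-1 (fun l => report j l w))).

(* The information preceding the rewards of round t: private randomness of all
   agents, outcomes up to round t, rewards before round t. *)
Definition past_gen (t : nat) : set_system W :=
  [set A | (exists j B, measurable B /\ A = seed j @^-1` B) \/
           (exists l o, (0 < l <= t)%N /\ A = outcome l @^-1` [set o]) \/
           (exists j l B, [/\ (0 < l < t)%N, measurable B &
                              A = reward j l @^-1` B])].

Definition past (t : nat) : set_system W := <<s past_gen t >>.

Record vcg_learn_run : Prop := VCGLearnRun {
  outcome_measurable : forall t o, measurable (outcome t @^-1` [set o]);
  outcome_rule : forall t w, (0 < t)%N ->
    follows_vcg_learn (outcome ^~ w) (fun j l => report j l w) t;
  seed_independent : forall B : 'I_n -> set E, (forall j, measurable (B j)) ->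
    P (\bigcap_j (seed j @^-1` B j)) = (\prod_(j < n) P (seed j @^-1` B j))%E;
  (* Given the past, the rewards of round t are independent across agents, and
     agent j's is drawn from the law attached to her current allocation. *)
  reward_rule : forall t, (0 < t)%N -> forall A, past t A ->
    forall (o : Omega) (B : 'I_n -> set (measurableTypeR R)),
    (forall j, measurable (B j)) ->
    P (A `&` outcome t @^-1` [set o] `&` \bigcap_j (reward j t @^-1` B j))
    = (P (A `&` outcome t @^-1` [set o])
       * \prod_(j < n) reward_law pb j (alloc pb j o) (B j))%E;
  report_rule : forall j t, mode prof j = ByRewards -> (0 < t)%N ->
    own_information_report j t }.

Definition truthful (i : 'I_n) : Prop :=
  match mode prof i with
  | ByBids => forall s, bid prof i s = value pb i s
  | ByRewards => forall t w, (0 < t)%N -> report i t w = reward i t w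
  end.

Definition ir_for (i : 'I_n) : Prop :=
  {ae P, forall w, forall T, 0 <= total_utility i T w}.

(* The limit need not exist for arbitrary behaviours of the other agents. *)
Definition asymptotically_ir_for (i : 'I_n) : Prop :=
  (0 <= limn_einf (fun T => (T%:R^-1)%:E * 'E_P[total_utility i T]))%E.

End run.
End vcg_learn.

(* Main.v *)
(**
  In an exploit round the chosen outcome maximises the upper-confidence welfare,
  so agent i's utility is at least [v_i - vhat_i] at her allocation (under AGE),
  minus the widths of the other agents' confidence intervals (under SEL).
  Everything thus reduces to two estimates.

  - Confidence failures. For a fixed allocation, the exponential of
    [lam * (X - v) - lam^2 sigma^2 / 2] summed over the used rounds is a
    supermartingale: whether a round is used depends on its outcome only, and
    given the past the reward follows the law of the received allocation.
    The number of samples at an exploit round lies between the number [q] of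
    completed explore phases and [q] plus the number [x] of earlier exploit
    rounds, so summing over allocations and over these [x + 1] values bounds the
    failure probability by [(x + 2)^(-3/2)], which sums to at most 2.

  - Confidence widths. Under ETC the number of samples is at least [q] and round
    [t] of bracket [q] satisfies [t <= 11/6 K q^(3/2)], so the sum of the
    [N^(-1/2)] is at most a multiple of the sum of [(K / t)^(1/3)]. Under OPT each
    exploit round increases the sample count of the received allocation, so this
    sum is at most [2 sum_s sqrt N_s <= 2 sqrt (|S| T)].
*)

Require Import Defs.
From HB Require Import structures.
From mathcomp Require Import all_boot all_order all_algebra.
From mathcomp Require Import all_classical all_reals all_analysis.
From mathcomp Require Import measurable_realfun ring lra.

Set Implicit Arguments.
Unset Strict Implicit.
Unset Printing Implicit Defensive.

Import Order.TTheory GRing.Theory Num.Theory.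
Import numFieldNormedType.Exports.

Local Open Scope classical_set_scope.
Local Open Scope ring_scope.

(** * Integrals of nonnegative functions and a product formula *)

(** The integral of a nonnegative function is a supremum over the simple functions below it, so
    monotonicity requires no measurability. *)
Lemma le_integral_ge0 d (T : measurableType d) (R : realType)
    (mu : {measure set T -> \bar R}) (f g : T -> \bar R) :
  (forall x, 0 <= f x)%E -> (forall x, f x <= g x)%E ->
  (\int[mu]_x f x <= \int[mu]_x g x)%E.
Proof.
move=> f0 fg; rewrite !ge0_integralTE//; last first.
  by move=> x; exact: le_trans (f0 x) (fg x).
apply: ereal_sup_le => _ [h hf <-].
by exists h => // x; exact: le_trans (hf x) (fg x).
Qed.

(* The integrals of [U^\+] and [U^\-] are defined and monotone without any
   measurability, so [U] need not be shown measurable. *)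
Lemma expectation_lower_bound d (T : measurableType d) (R : realType)
    (P : probability T R) (U g : T -> R) (c b : R) :
  0 <= c -> (forall w, 0 <= g w) -> measurable_fun setT g ->
  (forall w, - (c + g w) <= U w) -> (\int[P]_w (g w)%:E <= b%:E)%E ->
  ((- (c + b))%:E <= 'E_P[U])%E /\ ('E_P[fun w => (- U w)%R] <= (c + b)%:E)%E.
Proof.
move=> c0 g0 mg Ug gb.
have ineg : (\int[P]_w (fun w => (U w)%:E)^\- w <= (c + b)%:E)%E.
  have -> : ((c + b)%:E = c%:E + b%:E)%E by [].
  apply: (@le_trans _ _ (\int[P]_w (c%:E + (g w)%:E))%E); last first.
    rewrite ge0_integralD//=; last 2 first.
    - by move=> w _; rewrite lee_fin.
    - exact/measurable_EFinP.
    by rewrite integral_cst//=; rewrite probability_setT mule1 leeD2l.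
  apply: le_integral_ge0 => w; first exact: funeneg_ge0.
  rewrite funenegE -EFinN -EFinD -EFin_max lee_fin ge_max lerNl Ug/=.
  by rewrite addr_ge0.
have ipos : (0 <= \int[P]_w (fun w => (U w)%:E)^\+ w)%E by exact: integral_ge0.
rewrite unlock; split.
  rewrite integralE EFinN -[leLHS]add0e.
  by apply: leeD => //; rewrite leeN2.
rewrite integralE.
rewrite [X in (_ - X)%E](_ : _ = \int[P]_w (fun w => (U w)%:E)^\+ w)%E; last first.
  by apply: eq_integral => w _; rewrite funenegE funeposE !EFinN oppeK.
rewrite [X in (X - _)%E](_ : _ = \int[P]_w (fun w => (U w)%:E)^\- w)%E; last first.
  by apply: eq_integral => w _; rewrite funenegE funeposE !EFinN.
by rewrite -[leRHS]adde0; apply: leeD => //; rewrite leeNl oppe0.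
Qed.

(** Under [P] restricted to [A0], the past and [X] are independent and [X] follows [law]; their
    joint distribution is thus a product measure and Tonelli factorises the integral. This takes the
    place of conditioning on the past. *)
Lemma integral_past_mul d (W : measurableType d) (R : realType)
    (P : probability W R) (G : set_system W) (A0 : set W) (X : W -> R)
    (law : probability (measurableTypeR R) R)
    (M : W -> R) (h : measurableTypeR R -> R) :
  (forall A, <<s G >> A -> measurable A) -> measurable A0 ->
  measurable_fun setT (X : W -> measurableTypeR R) ->
  (forall A B, <<s G >> A -> measurable B ->
     P (A `&` A0 `&` X @^-1` B) = (P (A `&` A0) * law B)%E) ->
  measurable_fun setT (M : g_sigma_algebraType G -> R) ->
  (forall w, 0 <= M w) -> (forall w, ~ A0 w -> M w = 0) ->
  measurable_fun setT h -> (forall x, 0 <= h x) ->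
  (\int[P]_w (M w * h (X w))%:E =
   \int[P]_w (M w)%:E * \int[law]_x (h x)%:E)%E.
Proof.
move=> GW mA0 mX indep mM M0 MA0 mh h0.
(* The identity onto the coarser sigma-algebra turns the past into a random element, so that [M]
   becomes a function of the first coordinate of [phi]. *)
pose idG : W -> g_sigma_algebraType G := id.
have midG : measurable_fun setT idG.
  by move=> _ A mA; rewrite setTI; exact: GW.
pose phi w : g_sigma_algebraType G * measurableTypeR R := (idG w, X w).
have mphi : measurable_fun setT phi by exact/measurable_fun_pairP.
have A0oo : (P A0 < +oo)%E by rewrite ltey_eq fin_num_measure.
pose mu : {finite_measure set W -> \bar R} := mfrestr mA0 A0oo.
have muG_fin : fin_num_fun (pushforward mu idG).
  by move=> A mA; rewrite /pushforward fin_num_measure//; exact: GW.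
pose muG0 := measure_function_pushforward__canonical__measure_function_Measure mu midG.
pose muG : {finite_measure set (g_sigma_algebraType G) -> \bar R} :=
  HB.pack (Measure.sort muG0) (@Measure_isFinite.Build _ _ _ muG0 muG_fin).
pose joint := measure_function_pushforward__canonical__measure_function_Measure mu mphi.
have jointE A : measurable A -> (muG \x law)%E A = joint A.
  apply: product_measure_unique => {}A B mA mB.
  by rewrite /joint /muG /= /pushforward /= /mfrestr /mrestr -[RHS]indep// setIAC.
have int_mu (f : W -> \bar R) : (forall w, ~ A0 w -> f w = 0)%E ->
    (\int[P]_w f w = \int[mu]_w f w)%E.
  move=> f0; have fE : f = f \_ A0.
    by apply/funext => w; rewrite patchE; case: ifPn => // /negP; rewrite inE => /f0.
  rewrite fE -!integral_mkcond; apply: eq_measure_integral => A mA AA0.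
  by rewrite /mu /= /mfrestr /mrestr setIidl.
pose F (z : g_sigma_algebraType G * measurableTypeR R) := (M z.1 * h z.2)%:E.
have mF : measurable_fun setT F.
  apply/measurable_EFinP/measurable_funM.
  - exact: (measurableT_comp mM measurable_fst).
  - exact: (measurableT_comp mh measurable_snd).
have F0 z : (0 <= F z)%E by rewrite lee_fin mulr_ge0.
rewrite int_mu; last by move=> w /MA0 ->; rewrite mul0r.
transitivity (\int[joint]_z F z)%E.
  rewrite [RHS](ge0_integral_pushforward mphi); last 3 first.
  - exact: measurableT.
  - exact: mF.
  - by move=> z _; exact: F0.
  by rewrite preimage_setT.
transitivity (\int[muG \x law]_z F z)%E.
  by apply: eq_measure_integral => A mA _; exact/esym/jointE.
rewrite fubini_tonelli1//.
transitivity (\int[muG]_w ((M w)%:E * \int[law]_x (h x)%:E))%E.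
  apply: eq_integral => w _; rewrite /fubini_F /F /= -ge0_integralZl_EFin//.
  - by move=> x _; rewrite lee_fin.
  - exact/measurable_EFinP.
rewrite ge0_integralZr//; last 3 first.
- exact/measurable_EFinP.
- by move=> w _; rewrite lee_fin.
- by apply: integral_ge0 => x _; rewrite lee_fin.
congr (_ * _)%E; rewrite [RHS]int_mu; last by move=> w /MA0 ->.
rewrite [LHS]ge0_integral_pushforward//; first exact/measurable_EFinP.
by move=> w _; rewrite lee_fin.
Qed.

(** * The calendar of rounds and brackets *)

Section timeline_lemmas.
Variables (R : realType) (K : nat).
Hypothesis K0 : (0 < K)%N.

Lemma bracket_endS q :
  bracket_end R K q.+1 = (bracket_end R K q + (K + exploit_len R K q.+1))%N.
Proof. by rewrite /bracket_end big_nat_recr. Qed.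

Lemma bracket_end_mono : {homo bracket_end R K : p q / (p <= q)%N}.
Proof.
by apply: homo_leq => // [p q r|q]; [exact: leq_trans | rewrite bracket_endS leq_addr].
Qed.

Lemma bracket_unique t q :
  (bracket_end R K q < t <= bracket_end R K q.+1)%N -> bracket R K t = q.+1.
Proof.
move=> /andP[qt tq]; have t0 : (0 < t)%N by exact: leq_ltn_trans qt.
have [b0 /andP[bt tb]] := bracketP R K0 t0.
apply/eqP; rewrite eqn_leq; apply/andP; split; rewrite leqNgt; apply/negP => lt.
  have : (bracket_end R K q.+1 <= bracket_end R K (bracket R K t).-1)%N.
    by apply: bracket_end_mono; rewrite -ltnS prednK.
  by move=> /(leq_trans tq); rewrite leqNgt bt.
have : (bracket_end R K (bracket R K t) <= bracket_end R K q)%N.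
  exact: bracket_end_mono.
by move=> /(leq_trans tb); rewrite leqNgt qt.
Qed.

Lemma bracket_posE t : (0 < t)%N ->
  t = (bracket_end R K (bracket R K t).-1 + (bracket_pos R K t).+1)%N.
Proof.
move=> t0; have [_ /andP[bt _]] := bracketP R K0 t0.
by rewrite /bracket_pos prednK ?subn_gt0// subnKC// ltnW.
Qed.

Lemma bracket1 : bracket R K 1 = 1%N /\ bracket_pos R K 1 = 0%N.
Proof.
have b1 : bracket R K 1 = 1%N.
  by apply: bracket_unique; rewrite bracket_endS /bracket_end big_geq// add0n ltn_addr.
by split => //; rewrite /bracket_pos b1 /bracket_end /= big_geq.
Qed.

Lemma bracket_step t : (0 < t)%N ->
  (bracket R K t.+1 = bracket R K t /\
   bracket_pos R K t.+1 = (bracket_pos R K t).+1) \/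
  [/\ bracket R K t.+1 = (bracket R K t).+1, bracket_pos R K t.+1 = 0%N &
      (K <= (bracket_pos R K t).+1)%N].
Proof.
move=> t0; have [b0 /andP[bt tb]] := bracketP R K0 t0.
have tE := bracket_posE t0.
have posE s : bracket R K s = bracket R K t ->
    (bracket_end R K (bracket R K t).-1 < s)%N ->
    bracket_pos R K s = (s - bracket_end R K (bracket R K t).-1).-1.
  by rewrite /bracket_pos => ->.
have [eqt|neqt] := eqVneq t (bracket_end R K (bracket R K t)); last first.
  left; have bE : bracket R K t.+1 = bracket R K t.
    rewrite -[RHS]prednK//; apply: bracket_unique; rewrite prednK//.
    by rewrite (ltn_trans bt)//= ltn_neqAle neqt.
  by split => //; rewrite /bracket_pos bE subSn ?(ltnW bt)//= prednK// subn_gt0.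
right; have bE : bracket R K t.+1 = (bracket R K t).+1.
  by apply: bracket_unique; rewrite -eqt leqnn/= {1}eqt bracket_endS -addn1 leq_add2l ltn_addr.
split => //; first by rewrite /bracket_pos bE/= -eqt subSnn.
move: tE; rewrite {1}eqt -{1}(prednK b0) bracket_endS => /addnI <-.
exact: leq_addr.
Qed.

(* [m q p] is the weight of position [p] of the explore phase of bracket [q]. *)
Lemma explore_count (m : nat -> nat -> nat) (c t : nat) :
  (0 < t)%N -> ~~ explore_round R K t ->
  (forall q, \sum_(0 <= p < K) m q p = c)%N ->
  (\sum_(1 <= l < t) explore_round R K l * m (bracket R K l) (bracket_pos R K l)
   = bracket R K t * c)%N.
Proof.
move=> t0 xt mc.
(* Induction on the round: each finished bracket contributes [c], the current one the explored
   prefix, which [minn K] freezes once its explore phase is over. *)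
have H s : (\sum_(1 <= l < s.+2)
    explore_round R K l * m (bracket R K l) (bracket_pos R K l)
  = (bracket R K s.+1).-1 * c +
    \sum_(0 <= p < minn K (bracket_pos R K s.+1).+1) m (bracket R K s.+1) p)%N.
  elim: s => [|s IH].
    rewrite big_nat1 /explore_round; have [-> ->] := bracket1.
    by rewrite K0 (minn_idPr _)// big_nat1 mul1n.
  rewrite big_nat_recr//= {}IH /explore_round.
  have [b0 _] := bracketP R K0 (ltn0Sn s).
  have bE : ((bracket R K s.+1).-1 * c + c = bracket R K s.+1 * c)%N.
    by rewrite addnC -mulSn prednK.
  have [[-> ->]|[-> -> Kp]] := bracket_step (ltn0Sn s); last first.
    by rewrite K0 (minn_idPl Kp) (minn_idPr _)// mc big_nat1 mul1n/= bE.
  rewrite -addnA; congr addn.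
  have [pK|] := boolP ((bracket_pos R K s.+1).+1 < K)%N; last rewrite -leqNgt => pK.
    rewrite (minn_idPr (ltnW pK)) (minn_idPr pK).
    by rewrite [RHS]big_nat_recr ?leq0n// mul1n.
  by rewrite (minn_idPl pK) (minn_idPl (leqW pK)) mul0n addn0.
case: t t0 xt => // s _ xt; have := H s.
rewrite big_nat_recr//= (negbTE xt) mul0n addn0 => ->.
rewrite /explore_round -leqNgt in xt.
have [b0 _] := bracketP R K0 (ltn0Sn s).
by rewrite (minn_idPl _) ?leqW// mc addnC -mulSn prednK.
Qed.

(** Each of the first [q] brackets has at most [K + 5/6 K sqrt q] rounds, and [1 <= sqrt q] merges
    both terms into [(1 + 5/6) K sqrt q]. *)
Lemma leq_bracket_mul t : (0 < t)%N ->
  t%:R <= 11 / 6 * K%:R * ((bracket R K t)%:R * Num.sqrt (bracket R K t)%:R) :> R.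
Proof.
move=> t0; have [b0 /andP[_ tb]] := bracketP R K0 t0.
set q := bracket R K t in tb b0 *.
have q1 : 1 <= Num.sqrt q%:R :> R.
  by rewrite -[leLHS]sqrtr1 ler_wsqrtr// ler1n.
have K1 : 0 <= K%:R :> R by [].
have qq0 : 0 <= q%:R :> R by [].
apply: (@le_trans _ _ (bracket_end R K q)%:R); first by rewrite ler_nat.
apply: (@le_trans _ _ (\sum_(1 <= r < q.+1) (K%:R + 5 / 6 * K%:R * Num.sqrt q%:R))).
  rewrite /bracket_end natr_sum; apply: ler_sum_nat => r /andP[r1 rq].
  rewrite natrD lerD2l /exploit_len.
  apply: (@le_trans _ _ (5 / 6 * K%:R * Num.sqrt r%:R)).
      have h0 : 0 <= 5 / 6 * K%:R * Num.sqrt r%:R :> R by rewrite !mulr_ge0.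
    by have /andP[] := truncn_itv h0.
  by rewrite ler_wpM2l// ?mulr_ge0// ler_wsqrtr// ler_nat -ltnS.
rewrite sumr_const_nat subSS subn0 -[X in X <= _]mulr_natl.
have s1 : 0 <= Num.sqrt q%:R - 1 :> R by rewrite subr_ge0.
have := mulr_ge0 (mulr_ge0 K1 qq0) s1; lra.
Qed.

End timeline_lemmas.

(** * Deterministic estimates of sums *)

(** The hypothesis bounds [f t] by a multiple of [(k / t)^(1/3)], which is compared with the
    increments of the potential [2 k^(1/3) t^(2/3)]. *)
Lemma sum_cbrt_le (R : realType) (k : R) (f : nat -> R) (T : nat) :
  0 <= k ->
  (forall t, (0 < t <= T)%N -> 0 <= f t /\ f t ^+ 3 * t%:R <= 11 / 6 * k) ->
  \sum_(1 <= t < T.+1) f t <= 2 * (k `^ (1 / 3) * T%:R `^ (2 / 3)).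
Proof.
move=> k0 fP; set kap := k `^ (1 / 3).
have kap0 : 0 <= kap by exact: powR_ge0.
have cube (x : R) : 0 <= x -> (x `^ (1 / 3)) ^+ 3 = x.
  by move=> x0; rewrite -powR_mulrn ?powR_ge0// -powRrM divfK// powRr1.
have -> : T%:R `^ (2 / 3) = (T%:R `^ (1 / 3)) ^+ 2 :> R.
  rewrite -powR_mulrn ?powR_ge0// -powRrM; congr (_ `^ _); lra.
elim: T fP => [|T IH] fP.
  by rewrite big_geq// mulr_ge0// mulr_ge0// exprn_ge0// powR_ge0.
rewrite big_nat_recr//=.
have {}IH : \sum_(1 <= t < T.+1) f t <= 2 * (kap * (T%:R `^ (1 / 3)) ^+ 2).
  by apply: IH => t /andP[t0 tT]; apply: fP; rewrite t0/= leqW.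
move: IH.
set b := T%:R `^ (1 / 3); set a := T.+1%:R `^ (1 / 3).
have a3 : a ^+ 3 = T.+1%:R by exact: cube.
have b3 : b ^+ 3 = T%:R by exact: cube.
have a0 : 0 < a by rewrite powR_gt0.
have b0 : 0 <= b by exact: powR_ge0.
have [f0] := fP T.+1 (leqnn _); rewrite -a3.
set y := f T.+1 in f0 * => ya.
(* The constant [4/3] works because [(4/3)^3 = 64/27 >= 11/6]. *)
have ya_le : y * a <= 4 / 3 * kap.
  rewrite -(@ler_pXn2r _ 3)// ?nnegrE ?mulr_ge0 ?(ltW a0)//.
  rewrite !exprMn (le_trans ya)// /kap cube//; lra.
(* Concavity of [t^(2/3)] in terms of cube roots: [(a - b)^2 (a + 2b) = a^3 - 3ab^2 + 2b^3] is
   nonnegative and [a^3 - b^3 = 1]. *)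
have ab : 2 <= 3 * a * (a ^+ 2 - b ^+ 2).
  have : a ^+ 3 = b ^+ 3 + 1 by rewrite a3 b3 -natr1.
  have : 0 <= (a - b) ^+ 2 * (a + 2 * b).
    by rewrite mulr_ge0 ?sqr_ge0// addr_ge0 ?mulr_ge0// ltW.
  lra.
have y_le : y <= 2 * kap * (a ^+ 2 - b ^+ 2).
  rewrite -(ler_pM2r a0) (le_trans ya_le)//.
  have := ler_wpM2l kap0 ab; lra.
lra.
Qed.

(** As [x] increases by one exactly after the rounds in [b], the terms run through [(m + 2)^(-3/2)]
    for [m = 0, 1, ...], and each is at most [2 / sqrt (m + 1) - 2 / sqrt (m + 2)], which
    telescopes. *)
Lemma sum_inv_sqrt3_le2 (R : realType) (b : nat -> bool) (x : nat -> nat) (T : nat) :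
  (forall t, x t = \sum_(1 <= l < t) b l)%N ->
  \sum_(1 <= t < T.+1 | b t) ((x t).+2%:R * Num.sqrt (x t).+2%:R)^-1 <= 2 :> R.
Proof.
move=> xE.
suff H : \sum_(1 <= t < T.+1 | b t) ((x t).+2%:R * Num.sqrt (x t).+2%:R)^-1
    <= 2 - 2 * (Num.sqrt (x T.+1).+1%:R)^-1 :> R.
  by rewrite (le_trans H)// lerBlDr lerDl mulr_ge0// invr_ge0 sqrtr_ge0.
elim: T => [|T IH].
  by rewrite big_geq// xE big_geq// sqrtr1 invr1 mulr1 subrr.
rewrite big_mkcond big_nat_recr//= -big_mkcond/=.
have -> : x T.+2 = (x T.+1 + b T.+1)%N by rewrite !xE big_nat_recr.
case: (b T.+1); last by rewrite addn0 addr0.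
rewrite addn1 (le_trans (lerD IH (lexx _)))//.
set m := x T.+1; set p : R := Num.sqrt m.+1%:R; set r : R := Num.sqrt m.+2%:R.
have p0 : 0 < p by rewrite sqrtr_gt0.
have r0 : 0 < r by rewrite sqrtr_gt0.
have p2 : p ^+ 2 = m.+1%:R by rewrite sqr_sqrtr.
have r2 : r ^+ 2 = m.+2%:R by rewrite sqr_sqrtr.
have pr : p <= r by rewrite ler_wsqrtr// ler_nat.
have rp : r ^+ 2 = p ^+ 2 + 1 by rewrite r2 p2 -natr1.
suff : (m.+2%:R * r)^-1 <= 2 * p^-1 - 2 * r^-1.
  by move: (_ * r)^-1 p^-1 r^-1 => u v w; lra.
rewrite -r2 -(ler_pM2r (_ : 0 < p * r ^+ 3)); last by rewrite mulr_gt0 ?exprn_gt0.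
have -> : (r ^+ 2 * r)^-1 * (p * r ^+ 3) = p by field; rewrite gt_eqF.
have -> : (2 * p^-1 - 2 * r^-1) * (p * r ^+ 3) = 2 * r ^+ 2 * (r - p).
  by field; rewrite !gt_eqF.
have : (r - p) * (r + p) = 1 by rewrite -subr_sqr rp; ring.
nra.
Qed.

(** Every round in [b] raises the count of its own label from [m] to [m + 1], and [1 / sqrt (m + 1)
    <= 2 sqrt (m + 1) - 2 sqrt m]. The resulting sum of square roots over labels is bounded by
    Cauchy-Schwarz, since the counts add up to at most [T]. *)
Lemma sum_inv_sqrt_count_le (R : realType) (S : finType) (s : nat -> S)
    (b : nat -> bool) (N : nat -> nat) (T : nat) :
  (forall t, (0 < t <= T)%N -> b t ->
     (\sum_(1 <= l < t) (b l && (s l == s t)) < N t)%N) ->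
  \sum_(1 <= t < T.+1 | b t) (Num.sqrt (N t)%:R)^-1
    <= 2 * Num.sqrt (#|S| * T)%:R :> R.
Proof.
move=> NP; pose c t u := (\sum_(1 <= l < t) (b l && (s l == u)))%N.
have H : \sum_(1 <= t < T.+1 | b t) (Num.sqrt (N t)%:R)^-1
    <= \sum_u 2 * Num.sqrt (c T.+1 u)%:R :> R.
  elim: T NP => [|T IH] NP.
    by rewrite big_geq// sumr_ge0// => u _; rewrite mulr_ge0// sqrtr_ge0.
  rewrite big_mkcond big_nat_recr//= -big_mkcond/=.
  have cS u : c T.+2 u = (c T.+1 u + (b T.+1 && (s T.+1 == u)))%N.
    by rewrite /c big_nat_recr.
  have {}IH : \sum_(1 <= t < T.+1 | b t) (Num.sqrt (N t)%:R)^-1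
      <= \sum_u 2 * Num.sqrt (c T.+1 u)%:R :> R.
    by apply: IH => t /andP[t0 tT]; apply: NP; rewrite t0/= leqW.
  have := NP T.+1 (leqnn _); case bT: (b T.+1) => NT; last first.
    rewrite addr0 (le_trans IH)//.
    by under [leRHS]eq_bigr => u _ do rewrite cS bT addn0.
  have {NT} := NT isT; rewrite -/(c T.+1 (s T.+1)) => cN.
  rewrite (bigD1 (s T.+1))//= cS bT eqxx addn1.
  under [X in _ <= _ + X]eq_bigr => u us do rewrite cS bT eq_sym (negbTE us) addn0.
  rewrite (bigD1 (s T.+1))//= in IH.
  set m := c T.+1 (s T.+1) in cN IH *.
  set r : R := Num.sqrt m.+1%:R; set p : R := Num.sqrt m%:R in IH.
  have p0 : 0 <= p by exact: sqrtr_ge0.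
  have r0 : 0 < r by rewrite sqrtr_gt0.
  have rp : r ^+ 2 = p ^+ 2 + 1 by rewrite !sqr_sqrtr// -natr1.
  have Nr : (Num.sqrt (N T.+1)%:R)^-1 <= r^-1.
    by rewrite lef_pV2 ?posrE ?sqrtr_gt0 ?ltr0n ?(leq_trans _ cN)// ler_wsqrtr// ler_nat.
  have rV : r^-1 <= 2 * r - 2 * p.
    rewrite -(ler_pM2r r0) mulVf ?gt_eqF//.
    have := sqr_ge0 (r - p); rewrite sqrrB; lra.
  move: IH Nr rV; move: r^-1 (_ ^-1) => u v; lra.
apply: (le_trans H); rewrite -mulr_sumr ler_pM2l//.
case: (posnP T) => [T0|T0].
  rewrite big1 ?sqrtr_ge0// => u _.
  by rewrite /c T0 big_geq// sqrtr0.
have S0 : (0 < #|S|)%N by apply/card_gt0P; exists (s 0%N).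
set M : R := Num.sqrt _.
have M0 : 0 < M by rewrite sqrtr_gt0 ltr0n muln_gt0 S0.
have M2 : M ^+ 2 = #|S|%:R * T%:R by rewrite sqr_sqrtr// natrM.
have Sr : 0 < #|S|%:R :> R by rewrite ltr0n.
(* Cauchy-Schwarz through [2 y sqrt c <= c + y^2], with [y = sqrt (T / #|S|)], the value of [sqrt c]
   when [T] rounds are spread evenly over the labels. *)
pose y := M / #|S|%:R.
have y0 : 0 < y by rewrite divr_gt0.
have cT : \sum_u (c T.+1 u)%:R <= T%:R :> R.
  rewrite -natr_sum ler_nat /c exchange_big/=.
  apply: (@leq_trans (\sum_(1 <= l < T.+1) 1)%N); last first.
    by rewrite sum_nat_const_nat subSS subn0 muln1.
  apply: leq_sum => l _; rewrite (bigD1 (s l))//= eqxx big1 ?addn0 ?leq_b1//.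
  by move=> u us; rewrite eq_sym (negbTE us) andbF.
have : \sum_u 2 * y * Num.sqrt (c T.+1 u)%:R <= \sum_u ((c T.+1 u)%:R + y ^+ 2).
  apply: ler_sum => u _.
  have := sqr_ge0 (Num.sqrt (c T.+1 u)%:R - y).
  rewrite sqrrB sqr_sqrtr// => h; lra.
rewrite -mulr_sumr big_split/= sumr_const -[y ^+ 2 *+ _]mulr_natl.
have y2 : #|S|%:R * y ^+ 2 = T%:R.
  by rewrite /y expr_div_n M2; field; rewrite gt_eqF.
have yM : y * M = T%:R.
  by rewrite /y mulrAC -expr2 M2; field; rewrite gt_eqF.
rewrite cardT -cardE y2 => h.
rewrite -(ler_pM2l y0) yM.
lra.
Qed.

(** * Sample counts and single-round utility on a fixed path *)

Section path_bounds.
Context {R : realType} {sigma : R} {n : nat} {Omega S : finType}.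
Variables (pb : problem sigma n Omega S) (mech : mechanism (alloc pb)).
Variable prof : profile R n S.
Hypothesis sigma_gt0 : 0 < sigma.
Variables (om : nat -> Omega) (Y : 'I_n -> nat -> R).
Let K := size (explore mech).
Hypothesis K0 : (0 < K)%N.
Hypothesis follows : forall t, (0 < t)%N -> follows_vcg_learn mech prof om Y t.

Lemma ltn_kept q j s : (kept mech q j s < K)%N.
Proof.
have := @keptP _ _ _ _ mech q j s.
by rewrite ltnNge; case: leqP => // hK; rewrite onth_default ?size_map.
Qed.

(** An exploit round comes after the explore phase of its bracket, so each bracket so far has
    supplied exactly one kept sample of [s]; under [OPT] the earlier exploit rounds assigning [s]
    are added. *)
Lemma nsamplesE j s t : (0 < t)%N -> ~~ explore_round R K t ->
  nsamples mech om j t s =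
  (bracket R K t + \sum_(1 <= l < t) ~~ explore_round R K l &&
    ((if est mech is OPT then true else false) && (alloc pb j (om l) == s)))%N.
Proof.
move=> t0 xt.
rewrite -[in RHS](muln1 (bracket R K t)).
rewrite -(@explore_count R K K0 (fun q p => p == kept mech q j s))//; last first.
  move=> q; rewrite (big_cat_nat (n := kept mech q j s))//= ?(ltnW (ltn_kept _ _ _))//.
  rewrite [X in (_ + X)%N]big_ltn ?ltn_kept//= eqxx !big_nat !big1 //.
  - by move=> p /andP[/gtn_eqF -> _].
  - by move=> p /andP[_ /ltn_eqF ->].
rewrite -big_split/= /nsamples; apply: eq_big_nat => l /andP[l0 _].
rewrite /used -/K; case: ifP => xl; last by rewrite mul0n andbC.
rewrite mul1n addn0; congr nat_of_bool.
have := follows l0; rewrite /follows_vcg_learn -/K xl => oml.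
(* At the kept position the prescribed outcome assigns [s], so the allocation test in [used] holds
   there. *)
case: (bracket_pos R K l =P _) => [e|_]; last by rewrite andbF.
have := @keptP _ _ _ _ mech (bracket R K l) j s.
by rewrite -e onth_map oml /= => -[->]; rewrite eqxx.
Qed.

Definition exploit_count (t : nat) : nat :=
  \sum_(1 <= l < t) ~~ explore_round R K l.

(** The [t - 1] rounds before [t] split into [bracket t * K] explore rounds and the exploit rounds.
    The offset by two is chosen to match the logarithm's argument [t - q K + 1] in [radius]. *)
Lemma exploit_countE t : (0 < t)%N -> ~~ explore_round R K t ->
  t.+1 = ((exploit_count t).+2 + bracket R K t * K)%N.
Proof.
move=> t0 xt.
have <- := @explore_count R K K0 (fun _ _ => 1%N) K t t0 xt _; last first.
  by move=> _; rewrite sum_nat_const_nat subn0 muln1.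
rewrite /exploit_count !addSn -big_split/=.
rewrite (eq_bigr (fun=> 1%N)); first by rewrite sum_nat_const_nat muln1 subn1 prednK.
by move=> l _; rewrite muln1; case: explore_round.
Qed.

Lemma log_argE t : (0 < t)%N -> ~~ explore_round R K t ->
  t%:R - (bracket R K t * K)%:R + 1 = (exploit_count t).+2%:R :> R.
Proof.
move=> t0 xt; have := congr1 (fun m => m%:R : R) (exploit_countE t0 xt).
rewrite natrD -natr1; lra.
Qed.

Lemma nsamples_ge_bracket j s t : (0 < t)%N -> ~~ explore_round R K t ->
  (bracket R K t <= nsamples mech om j t s)%N.
Proof. by move=> t0 xt; rewrite nsamplesE// leq_addr. Qed.

Lemma nsamples_gt0 j s t : (0 < t)%N -> ~~ explore_round R K t ->
  (0 < nsamples mech om j t s)%N.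
Proof.
move=> t0 xt; apply: leq_trans (nsamples_ge_bracket j s t0 xt).
by have [] := bracketP R K0 t0.
Qed.

Lemma nsamples_range j s t : (0 < t)%N -> ~~ explore_round R K t ->
  exists2 k, (k <= exploit_count t)%N &
    nsamples mech om j t s = (bracket R K t + k)%N.
Proof.
move=> t0 xt; eexists; last exact: nsamplesE.
by apply: leq_sum => l _; case: explore_round; case: (est mech); case: eqP.
Qed.

Lemma vbar_ge0 j t s : 0 <= vbar mech prof om Y j t s.
Proof.
rewrite /vbar; case: mode; last by rewrite le_max lexx.
by case/andP: (bid_bound prof j s).
Qed.

Lemma vbar_le1 j t s : vbar mech prof om Y j t s <= 1.
Proof.
rewrite /vbar; case: mode; first by case/andP: (bid_bound prof j s).
by rewrite ge_max ler01 ge_min lexx.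
Qed.

Lemma radius_ge0 j t s : 0 <= Defs.radius mech prof om j t s.
Proof. by rewrite /Defs.radius; case: mode; rewrite // mulr_ge0// ltW. Qed.

Lemma value_ge0 j s : 0 <= value pb j s.
Proof. by case/andP: (value_bound pb j s). Qed.

Lemma utility_explore i t : explore_round R K t ->
  0 <= utility mech prof om Y i t.
Proof. by move=> xt; rewrite /utility /price -/K xt subr0 value_ge0. Qed.

(* The welfare-maximising outcome beats the maximiser of [F_but] because
   [f <= vhat] and agent i's own upper estimate is nonnegative; the price is
   then off by at most [vhat - g] for the other agents. *)
Lemma utility_exploit i t : (0 < t)%N -> ~~ explore_round R K t ->
  value pb i (alloc pb i (om t)) - vbar mech prof om Y i t (alloc pb i (om t))
   - Defs.radius mech prof om i t (alloc pb i (om t))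
   - (if price_rule mech is AGE then 0 else
      \sum_(j < n | j != i) 2 * Defs.radius mech prof om j t (alloc pb j (om t)))
  <= utility mech prof om Y i t.
Proof.
move=> t0 xt; rewrite /utility /price -/K (negbTE xt).
have := follows t0; rewrite /follows_vcg_learn -/K (negbTE xt) => opt.
have welfareE o : welfare mech prof om Y t o =
    welfare_but pb (vhat mech prof om Y) i t o + vhat mech prof om Y i t (alloc pb i o).
  by rewrite /welfare /welfare_but (bigD1 i)//= (addrC (vhat _ _ _ _ _ _ _)) addrA.
have F_le o : F_but mech prof om Y i t o <= welfare mech prof om Y t (om t).
  apply: le_trans (opt o); rewrite welfareE.
  apply: (@le_trans _ _ (welfare_but pb (vhat mech prof om Y) i t o)); last first.
    by rewrite lerDl addr_ge0 ?vbar_ge0 ?radius_ge0.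
  rewrite /F_but; case: price_rule => //.
  rewrite lerD2l; apply: ler_sum => j _; rewrite /vcheck /vhat.
  by have := radius_ge0 j t (alloc pb j o); lra.
have maxF : \big[Num.max/F_but mech prof om Y i t (om t)]_o F_but mech prof om Y i t o
    <= welfare mech prof om Y t (om t).
  by apply/bigmax_leP; split.
have Gle : welfare_but pb (vhat mech prof om Y) i t (om t)
    - (if price_rule mech is AGE then 0 else
      \sum_(j < n | j != i) 2 * Defs.radius mech prof om j t (alloc pb j (om t)))
    <= G_but mech prof om Y i t (om t).
  rewrite /G_but; case: price_rule; first by rewrite subr0.
  rewrite /welfare_but -addrA lerD2l -sumrB; apply: ler_sum => j _.
  rewrite /vhat /vcheck; lra.
move: maxF Gle; rewrite welfareE /vhat; lra.
Qed.

End path_bounds.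

(** * The exponential supermartingale of the used rewards *)

Section supermartingale.
Context {R : realType} {sigma : R} {n : nat} {Omega S : finType}.
Variables (pb : problem sigma n Omega S) (mech : mechanism (alloc pb)).
Variable prof : profile R n S.
Context {d dE : measure_display} {W : measurableType d} {E : measurableType dE}.
Variable P : probability W R.
Variables (outcome : nat -> W -> Omega).
Variables (reward report : 'I_n -> nat -> {RV P >-> measurableTypeR R}).
Variable seed : 'I_n -> {RV P >-> E}.
Hypothesis run : vcg_learn_run mech prof outcome reward report seed.
Variables (i : 'I_n) (s : S).

Lemma past_measurable t A : past outcome reward seed t A -> measurable A.
Proof.
suff : past outcome reward seed t `<=` measurable by apply.
apply: smallest_sub; first exact: sigma_algebra_measurable.
move=> _ [ [j [B [mB ->] ] ] | [ [l [a [_ ->] ] ] | [j [l [B [_ mB ->] ] ] ] ] ].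
- exact: measurable_funPTI.
- exact: (outcome_measurable run).
- exact: measurable_funPTI.
Qed.

Definition used_reward (l : nat) (w : W) : bool := used mech (outcome ^~ w) i s l.

(** For Gaussian rewards this is the log-likelihood ratio of the mean [v + lam sigma^2] against [v].
    Round [t] is left out, so that the value is known before its reward is drawn. *)
Definition log_likelihood (lam : R) (t : nat) (w : W) : R :=
  \sum_(1 <= l < t) (if used_reward l w
    then lam * (reward i l w - value pb i s) - lam ^+ 2 * sigma ^+ 2 / 2 else 0).

Lemma measurable_past_outcome t l (g : Omega -> bool) : (0 < l <= t)%N ->
  measurable_fun setT
    ((fun w => g (outcome l w)) :
      g_sigma_algebraType (past_gen outcome reward seed t) -> bool).
Proof.
move=> lt; apply: (measurable_fun_bool true).
rewrite setTI (_ : _ @^-1` _ = \bigcup_(o in [set o | g o]) outcome l @^-1` [set o]).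
  apply: fin_bigcup_measurable => [|o _]; first exact: finite_finset.
  by apply: sub_sigma_algebra; right; left; exists l, o.
apply/seteqP; split => [w /= gw|w [a /= ga ->]//].
by exists (outcome l w).
Qed.

Lemma measurable_past_reward t l : (0 < l < t)%N ->
  measurable_fun setT
    (reward i l : g_sigma_algebraType (past_gen outcome reward seed t) -> R).
Proof.
move=> lt _ B mB; rewrite setTI; apply: sub_sigma_algebra.
by right; right; exists i, l, B.
Qed.

Lemma measurable_log_likelihood lam t :
  measurable_fun setT (log_likelihood lam t :
    g_sigma_algebraType (past_gen outcome reward seed t) -> R).
Proof.
rewrite /log_likelihood.
under eq_fun do rewrite big_nat_cond big_mkcond.
apply: measurable_sum => l.
have [/andP[l0 lt]|_] := boolP (0 < l < t)%N; last exact: measurable_cst.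
apply: measurable_fun_ifT; last exact: measurable_cst.
  rewrite /used_reward.
  apply: (@measurable_past_outcome t l (fun o => used mech (fun=> o) i s l)).
  by rewrite l0 ltnW.
apply: measurable_funB; last exact: measurable_cst.
apply: measurable_funM; first exact: measurable_cst.
apply: measurable_funB; last exact: measurable_cst.
by apply: measurable_past_reward; rewrite l0.
Qed.

Lemma measurable_past_fun t d' (Y : measurableType d') (f : W -> Y) :
  measurable_fun setT (f : g_sigma_algebraType (past_gen outcome reward seed t) -> Y) ->
  measurable_fun setT f.
Proof.
move=> mf _ B mB; rewrite setTI; apply: (@past_measurable t).
by rewrite /past -[X in <<s _ >> X]setTI; exact: mf.
Qed.

Lemma measurable_log_likelihood_run lam t :
  measurable_fun setT (log_likelihood lam t).
Proof.
apply: (@measurable_past_fun t _ _ (log_likelihood lam t)).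
exact: measurable_log_likelihood.
Qed.

(** A marginal of [reward_rule]: the rewards of the other agents are left free by testing them
    against [setT]. *)
Lemma reward_conditional_law t (o : Omega) A (B : set (measurableTypeR R)) :
  (0 < t)%N -> past outcome reward seed t A -> measurable B ->
  P (A `&` outcome t @^-1` [set o] `&` reward i t @^-1` B)
  = (P (A `&` outcome t @^-1` [set o]) * reward_law pb i (alloc pb i o) B)%E.
Proof.
move=> t0 pA mB.
pose Bs j := if j == i then B else setT.
have mBs j : measurable (Bs j) by rewrite /Bs; case: ifP.
have := reward_rule run t0 pA o mBs.
rewrite (bigD1 i)//= big1 ?mule1; last first.
  by move=> j ji; rewrite /Bs (negbTE ji) probability_setT.
rewrite {2}/Bs eqxx => <-; congr (P (_ `&` _)).
apply/seteqP; split => w /=.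
  by move=> Bw j _ /=; rewrite /Bs; case: eqP => [->|].
by move=> /(_ i Logic.I) /=; rewrite /Bs eqxx.
Qed.

Lemma integral_exp_reward_le1 lam :
  (\int[reward_law pb i s]_x
     (expR (lam * (x - value pb i s) - lam ^+ 2 * sigma ^+ 2 / 2))%:E <= 1)%E.
Proof.
have [_ /(_ lam)] := reward_law_subgaussian pb i s.
set c := lam ^+ 2 * sigma ^+ 2 / 2; rewrite unlock => H.
under eq_integral do rewrite expRD mulrC EFinM.
rewrite ge0_integralZl_EFin//.
- by rewrite (le_trans (lee_wpmul2l _ H))// -EFinM -expRD addNr expR0.
- apply/measurable_EFinP; apply: measurableT_comp => //.
  by apply: measurable_funM => //; apply: measurable_funB.
Qed.

(** Splitting on the finitely many outcomes of the last round separates a weight fixed by the past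
    from a factor in the new reward, whose mean is at most one by sub-Gaussianity. *)
Lemma expectation_supermartingale lam t :
  (\int[P]_w (expR (log_likelihood lam t w))%:E <= 1)%E.
Proof.
(* The times [0] and [1] are both base cases, as rounds start at [1] and the sum is empty. *)
elim: t => [|[|t] IH].
- under eq_integral do rewrite /log_likelihood big_geq// expR0.
  by rewrite integral_cst//= probability_setT mul1e.
- under eq_integral do rewrite /log_likelihood big_geq// expR0.
  by rewrite integral_cst//= probability_setT mul1e.
set m := t.+1 in IH *.
pose M o w := expR (log_likelihood lam m w) * (outcome m w == o)%:R.
(* Whether round [m] is used depends on the path only through its outcome at [m], so the constant
   path [o] may stand for it. *)
pose h o x := if used mech (fun=> o) i s m
  then expR (lam * (x - value pb i s) - lam ^+ 2 * sigma ^+ 2 / 2) else 1.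
have mM o : measurable_fun setT
    (M o : g_sigma_algebraType (past_gen outcome reward seed m) -> R).
  apply: measurable_funM.
    by apply: measurableT_comp => //; exact: measurable_log_likelihood.
  rewrite (_ : (fun _ => _) = (fun w => if outcome m w == o then 1 else 0)); last first.
    by apply/funext => w; case: eqP.
  apply: measurable_fun_ifT; [|exact: measurable_cst|exact: measurable_cst].
  by apply: (@measurable_past_outcome m m (fun a => a == o)); rewrite leqnn.
have M0 o w : 0 <= M o w by rewrite mulr_ge0.
have mh o : measurable_fun setT (h o : measurableTypeR R -> R).
  rewrite /h; case: (used _ _ _ _ _); last exact: measurable_cst.
  apply: measurableT_comp => //; apply: measurable_funB => //.
  by apply: measurable_funM => //; apply: measurable_funB.
have h0 o x : 0 <= h o x by rewrite /h; case: ifP.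
have hX o : measurable_fun setT (fun w => h o (reward i m w)).
  exact: measurableT_comp.
under eq_integral => w _.
  rewrite (_ : (expR _)%:E = \sum_o (M o w * h o (reward i m w))%:E)%E; last first.
    rewrite sumEFin (bigD1 (outcome m w))//= big1 ?addr0; last first.
      by move=> o oE; rewrite /M eq_sym (negbTE oE) mulr0 mul0r.
    rewrite /M eqxx mulr1 /log_likelihood big_nat_recr//= expRD; congr (_ * _)%:E.
    rewrite /h /used_reward /used; case: (_ && _) => //; exact: expR0.
  over.
rewrite ge0_integral_sum//; last 2 first.
- move=> o; apply/measurable_EFinP; apply: measurable_funM => //.
  exact: (measurable_past_fun (mM o)).
- by move=> o w _; rewrite lee_fin mulr_ge0.
have Mle o : (\int[P]_w (M o w * h o (reward i m w))%:E <= \int[P]_w (M o w)%:E)%E.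
  rewrite (@integral_past_mul _ _ _ P (past_gen outcome reward seed m)
    (outcome m @^-1` [set o]) (reward i m) (reward_law pb i (alloc pb i o)))//.
  - rewrite -[leRHS]mule1; apply: lee_wpmul2l.
      by apply: integral_ge0 => w _; rewrite lee_fin.
    (* In a used round the allocation of [o] is [s], so the reward law is the one of [s]; otherwise
       the factor is [1]. *)
    rewrite /h; have [/andP[/eqP -> _]|_] := boolP (used mech (fun=> o) i s m).
      exact: integral_exp_reward_le1.
    by rewrite integral_cst//= probability_setT mul1e.
  - exact: past_measurable.
  - exact: (outcome_measurable run).
  - by move=> A B pA mB; exact: reward_conditional_law.
  - by move=> w /= /eqP /negbTE oE; rewrite /M oE mulr0.
apply: le_trans (lee_sum _ (fun o _ => Mle o)) _.
rewrite -ge0_integral_sum//; last 2 first.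
- move=> o; apply/measurable_EFinP; exact: (measurable_past_fun (mM o)).
- by move=> o w _; rewrite lee_fin.
apply: le_trans IH; apply: le_integral_ge0 => w.
  by apply: sume_ge0 => o _; rewrite lee_fin.
rewrite sumEFin lee_fin (bigD1 (outcome m w))//= big1 ?addr0; last first.
  by move=> o oE; rewrite /M eq_sym (negbTE oE) mulr0.
by rewrite /M eqxx mulr1.
Qed.

End supermartingale.

(** * Confidence widths, deviation probabilities and total utility *)

Section regret.
Context {R : realType} {sigma : R} {n : nat} {Omega S : finType}.
Variables (pb : problem sigma n Omega S) (mech : mechanism (alloc pb)).
Variable prof : profile R n S.
Hypothesis sigma_gt0 : 0 < sigma.
Let K := size (explore mech).
Let q t := bracket R K t.
Let x t := exploit_count mech t.
Let exploit t := ~~ explore_round R K t.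

(** The numerator under the square root in [radius], with [t - q K + 1] rewritten as [x t + 2]. *)
Definition log_factor (t : nat) : R := 5 * ln (x t).+2%:R + 2 * ln #|S|%:R.

Definition rate (T : nat) : R :=
  if est mech is ETC then K%:R `^ (1 / 3) * T%:R `^ (2 / 3)
  else Num.sqrt (#|S| * T)%:R.

Hypothesis S0 : (0 < #|S|)%N.

Lemma log_factor_ge0 t : 0 <= log_factor t.
Proof. by rewrite addr_ge0// mulr_ge0// ln_ge0// ler1n. Qed.

(** With [y = x t + 2], one deviation has probability at most the inverse [1 / (#|S| y^(5/2))]; a
    union over [#|S|] allocations and fewer than [y] sample sizes then leaves [y^(-3/2)]. *)
Lemma expR_log_factor t : expR (log_factor t / 2) =
  #|S|%:R * ((x t).+2%:R ^+ 2 * Num.sqrt (x t).+2%:R).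
Proof.
set y : R := (x t).+2%:R; have y0 : 0 < y by [].
have Sr : 0 < #|S|%:R :> R by rewrite ltr0n.
have -> : log_factor t / 2 = ln #|S|%:R + (ln y + ln y + 2^-1 * ln y).
  rewrite /log_factor -/y; lra.
rewrite !expRD !lnK ?posrE// -expr2; congr (_ * (_ * _)).
by rewrite -powR12_sqrt ?(ltW y0)// /powR gt_eqF.
Qed.

Section path.
Variables (om : nat -> Omega) (Y : 'I_n -> nat -> R).
Hypothesis K0 : (0 < K)%N.
Hypothesis follows : forall t, (0 < t)%N -> follows_vcg_learn mech prof om Y t.

Lemma sum_inv_sqrt_nsamples j T :
  \sum_(1 <= t < T.+1 | exploit t)
     (Num.sqrt (nsamples mech om j t (alloc pb j (om t)))%:R)^-1 <= 2 * rate T.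
Proof.
rewrite /rate; case estE: (est mech); last first.
  apply: (@sum_inv_sqrt_count_le R S (fun t => alloc pb j (om t)) exploit) => t /andP[t0 _] xt.
  rewrite (nsamplesE K0 follows)// estE.
  (* The strict inequality comes from the explore samples, at least one per allocation. *)
  by rewrite -[X in (X < _)%N]add0n -addSn leq_add//; have [] := bracketP R K0 t0.
rewrite big_mkcond; apply: sum_cbrt_le => // t /andP[t0 _].
case: ifPn => xt; last by rewrite lexx expr0n/= mul0r.
split; first by rewrite invr_ge0 sqrtr_ge0.
have [b0 _] := bracketP R K0 t0.
have qN := nsamples_ge_bracket K0 follows j (alloc pb j (om t)) t0 xt.
set r : R := Num.sqrt (bracket R K t)%:R.
have r0 : 0 < r by rewrite sqrtr_gt0 ltr0n.
(* With [r = sqrt q], the bound [N >= q] gives the factor [r^(-3)], which cancels the [r^3] in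
   [t <= 11/6 K r^3]. *)
apply: (@le_trans _ _ (r^-1 ^+ 3 * t%:R)).
  rewrite ler_wpM2r// ler_pXn2r// ?nnegrE ?invr_ge0 ?sqrtr_ge0//.
  rewrite lef_pV2 ?posrE ?sqrtr_gt0 ?ltr0n ?(leq_trans b0)//.
  by rewrite ler_wsqrtr// ler_nat.
have qE : (bracket R K t)%:R = r ^+ 2 by rewrite sqr_sqrtr.
have tK := leq_bracket_mul R K0 t0; rewrite -/r qE in tK.
rewrite exprVn [leLHS]mulrC ler_pdivrMr ?exprn_gt0//; lra.
Qed.

Lemma radius_le j t s T : (0 < t <= T)%N -> exploit t ->
  Defs.radius mech prof om j t s <=
    sigma * (Num.sqrt 5 * Num.sqrt (ln (#|S| * T)%:R)) *
      (Num.sqrt (nsamples mech om j t s)%:R)^-1.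
Proof.
move=> /andP[t0 tT] xt.
have S1 : 1 <= #|S|%:R :> R by rewrite ler1n.
have T1 : 1 <= T%:R :> R by rewrite ler1n (leq_trans t0).
rewrite /Defs.radius; case: mode.
  by rewrite !mulr_ge0 ?invr_ge0 ?sqrtr_ge0// ltW.
rewrite -mulrA ler_pM2l// -/K (log_argE K0)// -/(log_factor t).
rewrite sqrtrM ?log_factor_ge0// sqrtrV// ler_wpM2r ?invr_ge0 ?sqrtr_ge0//.
rewrite -sqrtrM// ler_wsqrtr// /log_factor.
(* At least one explore round precedes [t], hence [x t + 2 <= t <= T]. *)
have xT : (x t).+2%:R <= T%:R :> R.
  rewrite ler_nat (leq_trans _ tT)// -ltnS (exploit_countE K0 t0 xt).
  rewrite -[X in (X < _)%N]addn0 ltn_add2l muln_gt0 K0 andbT.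
  by have [] := bracketP R K0 t0.
have lnx : ln (x t).+2%:R <= ln T%:R :> R by rewrite ler_ln ?posrE// (lt_le_trans _ T1).
have lnS : 0 <= ln #|S|%:R :> R by exact: ln_ge0.
rewrite natrM lnM ?posrE ?(lt_le_trans ltr01)//; lra.
Qed.

Lemma sum_radius_le j T :
  \sum_(1 <= t < T.+1 | exploit t) 2 * Defs.radius mech prof om j t (alloc pb j (om t))
  <= 9 * sigma * Num.sqrt (ln (#|S| * T)%:R) * rate T.
Proof.
set L : R := Num.sqrt (ln _).
have L0 : 0 <= L by exact: sqrtr_ge0.
apply: (@le_trans _ _ (\sum_(1 <= t < T.+1 | exploit t) 2 * (sigma * (Num.sqrt 5 * L)) *
    (Num.sqrt (nsamples mech om j t (alloc pb j (om t)))%:R)^-1)).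
  rewrite big_nat_cond [leRHS]big_nat_cond; apply: ler_sum => t /andP[tT xt].
  by rewrite -[leRHS]mulrA ler_pM2l// radius_le.
rewrite -mulr_sumr.
(* The factor [9] arises as [2 * 2 * (9/4)]: the doubled radius, the [2] of the sum of inverse
   roots, and [sqrt 5 <= 9/4]. *)
have s5 : Num.sqrt 5 <= 9 / 4 :> R.
  rewrite -(@ler_pXn2r _ 2)// ?nnegrE ?sqrtr_ge0// ?sqr_sqrtr//; lra.
have s0 : 0 <= Num.sqrt 5 :> R by exact: sqrtr_ge0.
have A0 : 0 <= sigma * L by rewrite mulr_ge0// ltW.
have rate0 : 0 <= rate T.
  by rewrite /rate; case: (est mech); rewrite ?mulr_ge0 ?powR_ge0 ?sqrtr_ge0.
have h1 := ler_wpM2l (mulr_ge0 A0 s0) (sum_inv_sqrt_nsamples j T).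
have h2 := ler_wpM2l (mulr_ge0 A0 rate0) s5.
lra.
Qed.

Lemma utility_ge0_bids_age i t : (0 < t)%N ->
  price_rule mech = AGE -> mode prof i = ByBids ->
  (forall s, bid prof i s = value pb i s) ->
  0 <= utility mech prof om Y i t.
Proof.
move=> t0 age byb tr; have [xt|xt] := boolP (explore_round R K t).
  exact: utility_explore.
apply: le_trans (utility_exploit sigma_gt0 follows i t0 xt).
by rewrite age /vbar /Defs.radius byb tr /= !subrr.
Qed.

End path.

Section run.
Context {d dE : measure_display} {W : measurableType d} {E : measurableType dE}.
Variable P : probability W R.
Variables (outcome : nat -> W -> Omega).
Variables (reward report : 'I_n -> nat -> {RV P >-> measurableTypeR R}).
Variable seed : 'I_n -> {RV P >-> E}.
Hypothesis run : vcg_learn_run mech prof outcome reward report seed.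
Variable i : 'I_n.
Hypothesis tr : truthful pb prof reward report i.
Hypothesis K0 : (0 < K)%N.

Let follows w t (t0 : (0 < t)%N) := outcome_rule run w t0.

(** The Chernoff-optimal parameter for [N = q t + k] samples: at a deviation of one radius the
    exponent equals [log_factor t / 2]. It is deterministic because the sample count is fixed
    through [k]. *)
Definition tilt (t k : nat) : R := Num.sqrt (log_factor t / (q t + k)%:R) / sigma.

(* Dominates the indicator of the event that some clipped mean of agent i
   exceeds its upper confidence bound at round t: this event is covered by one
   supermartingale per allocation and per possible number of samples, since the
   latter lies between [q t] and [q t + x t]. *)
Definition deviation_mass (t : nat) (w : W) : R :=
  \sum_(s : S) \sum_(k < (x t).+1)
    expR (log_likelihood mech outcome reward i s (tilt t k) t w - log_factor t / 2).

Lemma deviation_mass_ge0 t w : 0 <= deviation_mass t w.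
Proof. by do 2 apply: sumr_ge0 => ? _; exact: expR_ge0. Qed.

Lemma log_likelihoodE s lam t w :
  log_likelihood mech outcome reward i s lam t w =
  lam * ((\sum_(1 <= l < t | used mech (outcome ^~ w) i s l) reward i l w)
         - (nsamples mech (outcome ^~ w) i t s)%:R * value pb i s)
  - (nsamples mech (outcome ^~ w) i t s)%:R * (lam ^+ 2 * sigma ^+ 2 / 2).
Proof.
rewrite /log_likelihood /nsamples natr_sum !mulr_suml.
rewrite [in RHS]big_mkcond -!sumrB/= mulr_sumr -sumrB.
by apply: eq_bigr => l _; rewrite /used_reward; case: (used _ _ _ _ _) => /=; ring.
Qed.

Lemma vbar_le_deviation s t w : mode prof i = ByRewards ->
  (0 < t)%N -> exploit t ->
  vbar mech prof (outcome ^~ w) (fun j l => report j l w) i t s <=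
  value pb i s + Defs.radius mech prof (outcome ^~ w) i t s + deviation_mass t w.
Proof.
move=> byr t0 xt.
have [|lt] := leP (vbar mech prof (outcome ^~ w) (fun j l => report j l w) i t s)
  (value pb i s + Defs.radius mech prof (outcome ^~ w) i t s).
  by move=> h; rewrite (le_trans h)// lerDl deviation_mass_ge0.
(* When the confidence bound fails, clipping caps the left side at [1], so it suffices that the
   single summand for [s] and the actual sample count is at least [1]. *)
apply: (@le_trans _ _ (0 + 0 + 1)); first by rewrite !add0r vbar_le1.
apply: lerD.
  by apply: lerD; [exact: value_ge0 | exact: radius_ge0].
have [k kx NE] := nsamples_range K0 (follows w) i s t0 xt.
rewrite /deviation_mass (bigD1 s)//= ler_wpDr//.
  by do 2 apply: sumr_ge0 => ? _; exact: expR_ge0.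
have kx' : (k < (x t).+1)%N by [].
rewrite (bigD1 (Ordinal kx'))//= ler_wpDr ?sumr_ge0//.
rewrite -[leLHS]expR0 ler_expR subr_ge0 log_likelihoodE.
set N : R := (nsamples _ _ _ _ _)%:R; set v := value pb i s in lt *.
have N0 : 0 < N by rewrite ltr0n (nsamples_gt0 K0 (follows w)).
set g : R := Num.sqrt (log_factor t / N).
have g0 : 0 <= g by exact: sqrtr_ge0.
have g2 : N * g ^+ 2 = log_factor t.
  by rewrite sqr_sqrtr ?mulr_ge0 ?log_factor_ge0 ?invr_ge0 ?(ltW N0)// mulrC divfK// gt_eqF.
have -> : tilt t k = g / sigma by rewrite /tilt -NE.
set X := \sum_(1 <= l < t | _) _.
have rE : Defs.radius mech prof (outcome ^~ w) i t s = sigma * g.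
  by rewrite /Defs.radius byr (log_argE K0).
have XE : sample_mean mech (outcome ^~ w) (fun j l => report j l w) i t s = X / N.
  rewrite /sample_mean -/N; congr (_ / _); rewrite big_nat_cond [RHS]big_nat_cond.
  apply: eq_bigr => l /andP[/andP[l0 _] _].
  by move: tr; rewrite /truthful byr => ->.
have vX : N * (v + sigma * g) <= X.
  rewrite mulrC -ler_pdivlMr// -XE -rE.
  (* Undoing the clipping: a nonnegative bound can be exceeded neither by [0] nor by the [min]
     unless the raw mean exceeds it. *)
  move: lt; rewrite /vbar byr lt_max => /orP[|].
    by rewrite ltNge addr_ge0// ?value_ge0 ?radius_ge0.
  by rewrite lt_min => /andP[_ /ltW].
have h : g / sigma * (N * (sigma * g)) <= g / sigma * (X - N * v).
  by apply: ler_wpM2l; [rewrite divr_ge0 ?(ltW sigma_gt0) | move: vX; rewrite mulrDr; lra].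
have e1 : g / sigma * (N * (sigma * g)) = log_factor t by rewrite -g2; field; rewrite gt_eqF.
have e2 : N * ((g / sigma) ^+ 2 * sigma ^+ 2 / 2) = log_factor t / 2.
  by rewrite -g2; field; rewrite gt_eqF.
rewrite e2; move: h; rewrite e1; lra.
Qed.

Lemma measurable_deviation_mass t : measurable_fun setT (deviation_mass t).
Proof.
apply: measurable_sum => s; apply: measurable_sum => k.
apply: measurableT_comp => //; apply: measurable_funB => //.
exact: (measurable_log_likelihood_run run).
Qed.

Lemma expectation_deviation_mass t :
  (\int[P]_w (deviation_mass t w)%:E
   <= (((x t).+2%:R * Num.sqrt (x t).+2%:R)^-1)%:E)%E.
Proof.
have mll s lam : measurable_fun setT (log_likelihood mech outcome reward i s lam t).
  exact: (measurable_log_likelihood_run run).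
under eq_integral => w _.
  rewrite /deviation_mass -sumEFin; under eq_bigr do rewrite -sumEFin.
  over.
rewrite ge0_integral_sum//; last 2 first.
- move=> s; apply: emeasurable_sum => k; apply/measurable_EFinP.
  by apply: measurableT_comp => //; apply: measurable_funB.
- by move=> s w _; apply: sume_ge0 => k _; rewrite lee_fin expR_ge0.
have term s lam : (\int[P]_w (expR (log_likelihood mech outcome reward i s lam t w
    - log_factor t / 2))%:E <= (expR (- (log_factor t / 2)))%:E)%E.
  under eq_integral do rewrite expRD mulrC EFinM.
  rewrite ge0_integralZl_EFin ?expR_ge0//; last first.
    by apply/measurable_EFinP; apply: measurableT_comp.
  rewrite -[leRHS]mule1; apply: lee_wpmul2l; first by rewrite lee_fin expR_ge0.
  exact: (expectation_supermartingale run).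
apply: (@le_trans _ _ (\sum_(s : S) \sum_(k < (x t).+1) (expR (- (log_factor t / 2)))%:E)%E).
  apply: lee_sum => s _; rewrite ge0_integral_sum//; last first.
    move=> k; apply/measurable_EFinP.
    by apply: measurableT_comp => //; apply: measurable_funB.
  by apply: lee_sum => k _; exact: term.
under eq_bigr do rewrite sumEFin.
rewrite sumEFin lee_fin !sumr_const card_ord cardT -cardE expRN expR_log_factor.
rewrite -[leLHS]mulr_natl -[_ *+ (x t).+1]mulr_natl.
set y : R := (x t).+2%:R; have y0 : 0 < y by [].
have r0 : 0 < Num.sqrt y by rewrite sqrtr_gt0.
have Sr : 0 < #|S|%:R :> R by rewrite ltr0n.
have -> : #|S|%:R * ((x t).+1%:R * (#|S|%:R * (y ^+ 2 * Num.sqrt y))^-1)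
   = (x t).+1%:R / y * (y * Num.sqrt y)^-1.
  by field; rewrite !gt_eqF.
apply: ler_piMl; first by rewrite invr_ge0 mulr_ge0// ltW.
by rewrite ler_pdivrMr// mul1r ler_nat.
Qed.

(** The agent's own estimate costs two radii per exploit round, one for the error of [vbar] and one
    for the optimism of [vhat]; under [SEL] the interval widths of the other agents make this [n]
    such sums. The additive [2] is the total expected deviation mass. *)
Lemma total_utility_bounds T :
  let c := (if price_rule mech is AGE then 1 else n%:R) *
     (9 * sigma * Num.sqrt (ln (#|S| * T)%:R) * rate T) in
  ((- (c + 2))%:E <= 'E_P[total_utility mech prof outcome report i T])%E /\
  ('E_P[fun w => (- total_utility mech prof outcome report i T w)%R] <= (c + 2)%:E)%E.
Proof.
set c1 := 9 * sigma * _ * _ => c.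
have rate0 : 0 <= rate T.
  by rewrite /rate; case: (est mech); rewrite ?mulr_ge0 ?powR_ge0 ?sqrtr_ge0.
have c1_ge0 : 0 <= c1 by rewrite !mulr_ge0 ?sqrtr_ge0// ltW.
have c0 : 0 <= c by rewrite mulr_ge0//; case: price_rule.
apply: (expectation_lower_bound (g := fun w =>
  \sum_(1 <= t < T.+1 | exploit t) deviation_mass t w)).
- exact: c0.
- by move=> w; apply: sumr_ge0 => t _; exact: deviation_mass_ge0.
- under eq_fun do rewrite big_mkcond.
  apply: measurable_sum => t; case: (exploit t); last exact: measurable_cst.
  exact: measurable_deviation_mass.
- move=> w; rewrite lerNl /total_utility -sumrN.
  pose rad j t := Defs.radius mech prof (outcome ^~ w) j t (alloc pb j (outcome t w)).
  have uP t : (0 < t)%N -> - utility mech prof (outcome ^~ w) (fun j l => report j l w) i t <=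
     if exploit t then
       (if price_rule mech is AGE then 2 * rad i t else \sum_(j < n) 2 * rad j t)
       + deviation_mass t w
     else 0.
    move=> t0; case: ifPn => [xt|]; last first.
      by rewrite negbK oppr_le0; exact: utility_explore.
    rewrite lerNl; apply: le_trans (utility_exploit sigma_gt0 (follows w) i t0 xt).
    set s := alloc pb i _.
    have : vbar mech prof (outcome ^~ w) (fun j l => report j l w) i t s
        <= value pb i s + rad i t + deviation_mass t w.
      case modeE: (mode prof i); last exact: vbar_le_deviation.
      move: tr; rewrite /truthful /vbar modeE => ->.
      by rewrite -addrA lerDl addr_ge0 ?deviation_mass_ge0 ?radius_ge0.
    rewrite -/(rad i t); case: price_rule; first lra.
    rewrite (bigD1 i)//=; lra.
  apply: (@le_trans _ _ (\sum_(1 <= t < T.+1) if exploit t then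
       (if price_rule mech is AGE then 2 * rad i t else \sum_(j < n) 2 * rad j t)
       + deviation_mass t w else 0)).
    by apply: ler_sum_nat => t /andP[t0 _]; exact: uP.
  rewrite -big_mkcond big_split/= lerD2r /c.
  case: price_rule; first by rewrite mul1r; exact: (sum_radius_le K0 (follows w)).
  rewrite exchange_big/= mulr_natl -[n in leRHS]card_ord -sumr_const.
  by apply: ler_sum => j _; exact: (sum_radius_le K0 (follows w)).
under eq_integral do rewrite big_mkcond -sumEFin.
rewrite ge0_integral_sum//; last 2 first.
- move=> t; apply/measurable_EFinP; case: (exploit t); last exact: measurable_cst.
  exact: measurable_deviation_mass.
- by move=> t w _; rewrite lee_fin; case: ifP => // _; exact: deviation_mass_ge0.
apply: (@le_trans _ _ (\sum_(1 <= t < T.+1)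
    (if exploit t then ((x t).+2%:R * Num.sqrt (x t).+2%:R)^-1 else 0)%:E)%E).
  apply: lee_sum => t _; case: (exploit t); last by rewrite integral0.
  exact: expectation_deviation_mass.
rewrite sumEFin lee_fin -big_mkcond/=.
exact: sum_inv_sqrt3_le2.
Qed.

End run.
End regret.

(** * Limits and growth of the rates *)

Lemma limn_einf_ge0 (R : realType) (u : (\bar R)^nat) (v : R^nat) :
  v @ \oo --> 0 -> (forall T, (0 < T)%N -> ((- v T)%:E <= u T)%E) ->
  (0 <= limn_einf u)%E.
Proof.
move=> v0 uv; rewrite limn_einf_lim; apply/lee_addgt0Pr => e e0.
rewrite -leeBlDr// sub0e; apply: lime_ge; first exact: is_cvg_einfs.
have /cvgrPdist_lt/(_ e e0)[m _ vm] := v0.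
exists m.+1 => // k /= mk; apply: le_ereal_inf_tmp => _ [l /= kl <-].
have l0 : (0 < l)%N by rewrite (leq_trans _ kl)// (leq_trans _ mk).
apply: le_trans (uv l l0); rewrite lee_fin lerN2.
have := vm l (leq_trans (ltnW mk) kl).
by rewrite sub0r normrN => /ltW; apply: le_trans; exact: ler_norm.
Qed.

Lemma cvg_inv_root6 (R : realType) (D : R) :
  (fun T : nat => D * (T%:R `^ (1 / 6))^-1) @ \oo --> (0 : R).
Proof.
rewrite -(mulr0 D); apply: cvgMr; apply/gtr0_cvgV0.
  by exists 1%N => // T /= T0; rewrite powR_gt0// ltr0n.
apply/cvgryPge => A; near=> T.
apply: (@le_trans _ _ `|A|); first exact: ler_norm.
have -> : `|A| = (`|A| ^+ 6) `^ (1 / 6).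
  by rewrite -powR_mulrn// -powRrM mulrC divfK// powRr1.
apply: ge0_ler_powR; rewrite ?nnegrE ?exprn_ge0//.
by near: T; exact: nbhs_infty_ger.
Unshelve. all: by end_near. Qed.

Lemma natr_powR_ge1 (R : realType) (m : nat) (r : R) :
  (0 < m)%N -> 0 <= r -> 1 <= m%:R `^ r.
Proof.
move=> m0 r0; apply: (@le_trans _ _ (1 `^ r)); first by rewrite powR1.
by rewrite ge0_ler_powR ?nnegrE// ler1n.
Qed.

Section growth.
Context {R : realType} {sigma : R} {n : nat} {Omega S : finType}.
Variables (pb : problem sigma n Omega S) (mech : mechanism (alloc pb)).
Hypothesis sigma_gt0 : 0 < sigma.
Hypothesis S0 : (0 < #|S|)%N.
Let K := size (explore mech).
Hypothesis K0 : (0 < K)%N.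
Let L T : R := ln (#|S| * T)%:R.

Lemma rate_ge1 T : (0 < T)%N -> 1 <= rate mech T.
Proof.
move=> T0.
rewrite /rate; case: est; last first.
  by rewrite -[leLHS]sqrtr1 ler_wsqrtr// ler1n muln_gt0 S0.
by rewrite mulr_ege1// natr_powR_ge1// divr_ge0.
Qed.

(** In terms of [tau = T^(1/6)], the bound [ln z < z] at [tau^2] gives [sqrt (L T) = O(tau)], and
    both rates are [O(tau^4)]. The product is [O(tau^5)], smaller than [T = tau^6] by one factor
    [tau]. *)
Lemma rate_sublinear : exists D : R, forall T, (0 < T)%N ->
  9 * sigma * Num.sqrt (L T) * rate mech T + 2 <= T%:R * (D * (T%:R `^ (1 / 6))^-1).
Proof.
pose A := Num.sqrt (#|S|%:R + 3 : R).
pose B := K%:R `^ (1 / 3) + Num.sqrt #|S|%:R : R.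
exists (9 * sigma * (A * B) + 2) => T T0.
set tau := T%:R `^ (1 / 6).
have tau1 : 1 <= tau by apply: natr_powR_ge1 => //; rewrite divr_ge0.
have tau0 : 0 < tau by exact: lt_le_trans tau1.
have T6 : T%:R = tau ^+ 6 by rewrite -powR_mulrn ?powR_ge0// -powRrM divfK// powRr1.
have tau_ge1 m : 1 <= tau ^+ m by exact: exprn_ege1.
have tau_gt0 m : 0 < tau ^+ m by exact: exprn_gt0.
have L_le : Num.sqrt (L T) <= A * tau.
  rewrite -[leRHS]ger0_norm ?mulr_ge0 ?sqrtr_ge0 ?(ltW tau0)// -sqrtr_sqr ler_wsqrtr//.
  rewrite exprMn sqr_sqrtr ?addr_ge0// /L natrM lnM ?posrE ?ltr0n//.
  have -> : T%:R = (tau ^+ 2) ^+ 3 by rewrite T6 -exprM.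
  rewrite lnXn// -[_ *+ 3]mulr_natl.
  have := ltW (ln_sublinear (tau_gt0 2%N)).
  have S1 : 0 < #|S|%:R :> R by rewrite ltr0n.
  have := ltW (ln_sublinear S1).
  have := ler_wpM2l (ltW S1) (tau_ge1 2%N).
  lra.
have rate_le : rate mech T <= B * tau ^+ 4.
  rewrite /B mulrDl /rate; case: est.
    rewrite (_ : T%:R `^ (2 / 3) = tau ^+ 4).
      by rewrite lerDl mulr_ge0 ?sqrtr_ge0// ltW.
    by rewrite -powR_mulrn ?powR_ge0// -powRrM; congr (_ `^ _); lra.
  have -> : Num.sqrt (#|S| * T)%:R = Num.sqrt #|S|%:R * tau ^+ 3 :> R.
    rewrite natrM sqrtrM//; congr (_ * _).
    by rewrite T6 (exprM tau 3 2) sqrtr_sqr ger0_norm// ltW.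
  have h : tau ^+ 3 <= tau ^+ 4 by rewrite ler_weXn2l.
  have := ler_wpM2l (sqrtr_ge0 #|S|%:R) h.
  have := mulr_ge0 (powR_ge0 K%:R (1 / 3)) (ltW (tau_gt0 4%N)).
  lra.
have B0 : 0 <= B by rewrite addr_ge0 ?powR_ge0 ?sqrtr_ge0.
have h := ler_pM (sqrtr_ge0 _) (le_trans ler01 (rate_ge1 T0)) L_le rate_le.
have -> : T%:R * ((9 * sigma * (A * B) + 2) * tau^-1) = (9 * sigma * (A * B) + 2) * tau ^+ 5.
  by rewrite T6; field; rewrite gt_eqF.
have := tau_ge1 5%N.
have := ler_wpM2l (ltW sigma_gt0) h.
lra.
Qed.

(** Since [L T >= 1/2] and the rate is at least [1], one has [sqrt (L T) <= 2 L T] and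
    [2 <= 4 L T * rate], which explains both constants. *)
Lemma softO_absorb T : (1 < T)%N ->
  9 * sigma * Num.sqrt (L T) * rate mech T + 2 <= (18 * sigma + 4) * L T ^+ 1 * rate mech T.
Proof.
move=> T1.
have L12 : 1 / 2 <= L T.
  (* The estimate [ln 2 >= 1/2] is [ln (1 + z) <= z] at [z = -1/2]. *)
  have : ln (2^-1 : R) <= - (1 / 2).
    have h : -1 < - (1 / 2) :> R by lra.
    by have := le_ln1Dx h; rewrite (_ : 1 + - (1 / 2) = 2^-1)//; lra.
  rewrite lnV ?posrE// lerN2 => /le_trans; apply.
  by rewrite ler_ln ?posrE ?ltr0n ?muln_gt0 ?S0 ?(ltnW T1)//
    ler_nat (leq_trans T1)// leq_pmull.
rewrite expr1.
have r1 := rate_ge1 (ltnW T1).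
have sq : Num.sqrt (L T) ^+ 2 = L T by rewrite sqr_sqrtr//; lra.
have s12 : 1 / 2 <= Num.sqrt (L T).
  rewrite -(@ler_pXn2r _ 2)// ?nnegrE ?sqrtr_ge0// sq; lra.
have s_le : Num.sqrt (L T) <= 2 * L T.
  by have := ler_wpM2l (sqrtr_ge0 (L T)) s12; rewrite -expr2 sq; lra.
have h1 := ler_wpM2l (mulr_ge0 (ltW sigma_gt0) (le_trans ler01 r1)) s_le.
have h3 : 1 / 2 * 1 <= L T * rate mech T by apply: ler_pM.
lra.
Qed.

End growth.

(** * Assembly of the utility guarantees *)

Theorem theorem3 (R : realType) (sigma : R) (sigma_gt0 : 0 < sigma) :
  (* C and k are the hidden constant and polylog exponent of the soft-O bounds *)
  exists (C : R) (k : nat),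
  forall (n : nat) (Omega S : finType) (pb : problem sigma n Omega S)
    (mech : mechanism (alloc pb)) (prof : profile R n S)
    (d dE : measure_display) (W : measurableType d) (E : measurableType dE)
    (P : probability W R)
    (outcome : nat -> W -> Omega)
    (reward report : 'I_n -> nat -> {RV P >-> measurableTypeR R})
    (seed : 'I_n -> {RV P >-> E}),
  vcg_learn_run mech prof outcome reward report seed ->
  forall i : 'I_n, truthful pb prof reward report i ->
  let K := size (explore mech) in
  let U := total_utility mech prof outcome report i in
  let L (T : nat) : R := ln (#|S| * T)%:R in
  let etc_rate (T : nat) : R := K%:R `^ (1 / 3) * T%:R `^ (2 / 3) in
  let opt_rate (T : nat) : R := Num.sqrt (#|S| * T)%:R in
  let softO (f : nat -> R) := forall T : nat, (2 * K < T)%N ->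
    ('E_P[fun w => (- U T w)%R] <= (C * L T ^+ k * f T)%:E)%E in
  (est mech = ETC ->
    [/\ price_rule mech = AGE -> mode prof i = ByBids ->
          ir_for mech prof outcome report i,
        price_rule mech = AGE -> mode prof i = ByRewards ->
          [/\ forall T : nat, (2 * K < T)%N ->
                ('E_P[U T] >= (- 10 * sigma * Num.sqrt (L T) * etc_rate T - 4)%:E)%E,
              softO etc_rate
            & asymptotically_ir_for mech prof outcome report i]
      & price_rule mech = SEL ->
          (forall T : nat, (2 * K < T)%N ->
             ('E_P[U T] >=
                (- 10 * sigma * n%:R * Num.sqrt (L T) * etc_rate T - 4)%:E)%E) /\
          softO (fun T => n%:R * etc_rate T)]) /\
  (est mech = OPT ->
    [/\ price_rule mech = AGE -> mode prof i = ByBids ->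
          ir_for mech prof outcome report i,
        price_rule mech = AGE -> mode prof i = ByRewards ->
          [/\ forall T : nat, (2 * K < T)%N ->
                ('E_P[U T] >= (- 9 * sigma * Num.sqrt ((#|S| * T)%:R * L T) - 6)%:E)%E,
              softO opt_rate
            & asymptotically_ir_for mech prof outcome report i]
      & price_rule mech = SEL ->
          (forall T : nat, (2 * K < T)%N ->
             ('E_P[U T] >=
                (- 9 * sigma * n%:R * Num.sqrt ((#|S| * T)%:R * L T) - 6)%:E)%E) /\
          softO (fun T => n%:R * opt_rate T)]).
Proof.
exists (18 * sigma + 4), 1%N.
move=> n Omega S pb mech prof d dE W E P outcome reward report seed run i tr K U L
  etc_rate opt_rate softO.
have S0 : (0 < #|S|)%N.
  (* [W] is pointed, so the run provides an outcome and hence an allocation; the explore phase,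
     which must cover it, is then nonempty. *)
  by apply/card_gt0P; exists (alloc pb i (outcome 0%N point)).
have K0 : (0 < K)%N.
  have /card_gt0P[s _] := S0.
  by have := explore_covers mech i s; rewrite /K; case: explore.
have etcE T : est mech = ETC -> rate mech T = etc_rate T by rewrite /rate => ->.
have optE T : est mech = OPT -> rate mech T = opt_rate T by rewrite /rate => ->.
have bounds := total_utility_bounds sigma_gt0 S0 run tr K0.
have n1 : 1 <= n%:R :> R by rewrite ler1n (leq_ltn_trans _ (ltn_ord i)).
have lnT0 T : (2 * K < T)%N -> (1 < T)%N.
  by apply: leq_ltn_trans; rewrite muln_gt0.
have sL0 T : (0 < T)%N -> 0 <= sigma * Num.sqrt (L T) * rate mech T.
  move=> T0; rewrite !mulr_ge0 ?sqrtr_ge0 ?(ltW sigma_gt0)//.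
  exact: le_trans ler01 (rate_ge1 S0 K0 T0).
have absorb T : (2 * K < T)%N ->
    9 * sigma * Num.sqrt (L T) * rate mech T + 2 <= (18 * sigma + 4) * L T ^+ 1 * rate mech T.
  by move=> /lnT0 T1; exact: softO_absorb.
(* Leaving [c >= 9] and [b >= 2] free covers both pairs of constants, [10] and [4] for [ETC], [9]
   and [6] for [OPT]. *)
have lower_age T (c b : R) : price_rule mech = AGE -> (0 < T)%N -> 9 <= c -> 2 <= b ->
    ((- c * sigma * Num.sqrt (L T) * rate mech T - b)%:E <= 'E_P[U T])%E.
  move=> age T0 c9 b2; have [+ _] := bounds T; rewrite age mul1r; apply: le_trans.
  by rewrite lee_fin; have := ler_wpM2r (sL0 T T0) c9; lra.
have lower_sel T (c b : R) : price_rule mech = SEL -> (0 < T)%N -> 9 <= c -> 2 <= b ->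
    ((- c * sigma * n%:R * Num.sqrt (L T) * rate mech T - b)%:E <= 'E_P[U T])%E.
  move=> sel T0 c9 b2; have [+ _] := bounds T; rewrite sel; apply: le_trans.
  rewrite lee_fin.
  by have := ler_wpM2r (mulr_ge0 (le_trans ler01 n1) (sL0 T T0)) c9; lra.
have upper_age T : price_rule mech = AGE -> (2 * K < T)%N ->
    ('E_P[fun w => (- U T w)%R] <= ((18 * sigma + 4) * L T ^+ 1 * rate mech T)%:E)%E.
  move=> age TK; have [_] := bounds T; rewrite age mul1r => /le_trans; apply.
  by rewrite lee_fin absorb.
have upper_sel T : price_rule mech = SEL -> (2 * K < T)%N ->
    ('E_P[fun w => (- U T w)%R] <=
     ((18 * sigma + 4) * L T ^+ 1 * (n%:R * rate mech T))%:E)%E.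
  move=> sel TK; have [_] := bounds T; rewrite sel => /le_trans; apply.
  rewrite lee_fin.
  by have := ler_wpM2l (le_trans ler01 n1) (absorb T TK); lra.
have sqrtE T : Num.sqrt ((#|S| * T)%:R * L T) = Num.sqrt (L T) * opt_rate T.
  by rewrite sqrtrM// mulrC.
have ir : price_rule mech = AGE -> mode prof i = ByBids ->
    ir_for mech prof outcome report i.
  move=> age byb; apply: aeW => w T; rewrite /total_utility big_nat_cond.
  apply: sumr_ge0 => t /andP[/andP[t0 _] _].
  apply: (utility_ge0_bids_age sigma_gt0 _ t0 age byb).
    by move=> l l0; exact: (outcome_rule run).
  by move: tr; rewrite /truthful byb.
have air : price_rule mech = AGE -> asymptotically_ir_for mech prof outcome report i.
  move=> age; have [D hD] := @rate_sublinear _ _ _ _ _ _ mech sigma_gt0 S0 K0.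
  apply: (limn_einf_ge0 (cvg_inv_root6 D)) => T T0.
  have Tr : 0 < T%:R :> R by rewrite ltr0n.
  have [+ _] := bounds T; rewrite age mul1r => lb.
  apply: (@le_trans _ _ ((T%:R^-1)%:E *
      (- (9 * sigma * Num.sqrt (L T) * rate mech T + 2))%:E)%E).
    rewrite -EFinM lee_fin mulrN lerN2 [leLHS]mulrC ler_pdivrMr// [leRHS]mulrC; exact: hD.
  by apply: lee_wpmul2l => //; rewrite lee_fin invr_ge0.
split=> [e|e]; split.
- exact: ir.
- move=> age byr; split; last exact: air.
    by move=> T TK; rewrite -etcE//; apply: lower_age; rewrite ?(ltnW (lnT0 _ TK))//; lra.
  by move=> T TK; rewrite -etcE//; exact: upper_age.
- move=> sel; split=> T TK; rewrite -etcE//; last exact: upper_sel.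
  by apply: lower_sel; rewrite ?(ltnW (lnT0 _ TK))//; lra.
- exact: ir.
- move=> age byr; split; last exact: air.
    move=> T TK; rewrite sqrtE -optE// mulrA.
    by apply: lower_age; rewrite ?(ltnW (lnT0 _ TK))//; lra.
  by move=> T TK; rewrite -optE//; exact: upper_age.
- move=> sel; split=> T TK; last by rewrite -optE//; exact: upper_sel.
  rewrite sqrtE -optE// mulrA.
  by apply: lower_sel; rewrite ?(ltnW (lnT0 _ TK))//; lra.
Qed.
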